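(* Let $m,n\ge1$ be integers, let $H$ be a complex Hilbert space, and let $T\in L(H)^n$ be a commuting tuple that is regular at $z=0$ and satisfies the identity $(T^*T)^{-1}=(\oplus\Delta_T)|\,\mathrm{Im}\,T^*$, where $\Delta_T=\sum_{j=0}^{m-1}(-1)^j\binom{m}{j+1}\sigma_T^j(1_H)$. The following conditions on $T$ are equivalent: (i) $T$ is analytic, that is, $\bigcap_{k=0}^\infty\sum_{|\alpha|=k}T^\alpha H=\{0\}$; (ii) $\|x\|^2=\big\|\sum_{\alpha\in\mathbb N^n}\gamma_\alpha\,(P_{W(T)}L^\alpha x)\,z^\alpha\big\|^2_{H_m(\mathbb B,W(T))}$ for all $x\in H$; (iii) $T$ is of type $C_{\cdot0}$, that is, $\sigma_T^k(1_H)\to0$ in the strong operator topology as $k\to\infty$; (iv) $T$ is unitarily equivalent to $M_z\in L(H_m(\mathbb B,\mathcal D))^n$ for some Hilbert space $\mathcal D$.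
   Context: $L(H)$ is the algebra of bounded linear operators on $H$. For a commuting tuple $T=(T_1,\ldots,T_n)\in L(H)^n$, the same letter $T$ denotes the row operator $T:H^n\to H$, $(h_i)_{i=1}^n\mapsto\sum_{i=1}^n T_ih_i$, with adjoint $T^*:H\to H^n$, $h\mapsto(T_i^*h)_{i=1}^n$. If $TH^n=\sum_iT_iH$ is closed, put $W(T)=H\ominus\sum_{i=1}^nT_iH$, and let $P_{W(T)}$ be the orthogonal projection onto $W(T)$. For $z\in\mathbb C^n$, $Z:H^n\to H$ is the row operator $(h_i)\mapsto\sum_i z_ih_i$, and $\|z\|$ is the Euclidean norm. $T$ is regular at $z=0$ if $TH^n\subset H$ is closed and there is $\epsilon>0$ such that for all $z\in\mathbb C^n$ with $\|z\|<\epsilon$ the subspace $(T-Z)H^n\subset H$ is closed and $H$ is the algebraic direct sum $H=(T-Z)H^n\oplus W(T)$. Since $TH^n$ is closed, $T^*T:\mathrm{Im}\,T^*\to\mathrm{Im}\,T^*$ is invertible, and $(T^*T)^{-1}$ denotes its inverse. $\sigma_T:L(H)\to L(H)$ is $\sigma_T(X)=\sum_{i=1}^nT_iXT_i^*$, $\sigma_T^j$ is its $j$-th iterate, and for $X\in L(H)$, $\oplus X\in L(H^n)$ is $(h_i)_i\mapsto(Xh_i)_i$. The operator identity means that both sides agree at every vector of $\mathrm{Im}\,T^*\subset H^n$. Under the stated identity, $L=(T^*T)^{-1}T^*:H\to H^n$ has components $L_i=\Delta_TT_i^*\in L(H)$; these operators commute, so $L^\alpha=L_1^{\alpha_1}\cdots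 L_n^{\alpha_n}$ is well defined for $\alpha\in\mathbb N^n$ (here $0\in\mathbb N$). Put $\gamma_\alpha=|\alpha|!/\alpha!$. $\mathbb B\subset\mathbb C^n$ is the open Euclidean unit ball. For a Hilbert space $\mathcal E$, $H_m(\mathbb B,\mathcal E)$ is the $\mathcal E$-valued analytic functional Hilbert space on $\mathbb B$ with reproducing kernel $(z,w)\mapsto(1-\langle z,w\rangle)^{-m}1_{\mathcal E}$; equivalently the space of all analytic $f=\sum_{\alpha}f_\alpha z^\alpha:\mathbb B\to\mathcal E$ with $\|f\|^2=\sum_\alpha\|f_\alpha\|^2/\rho_m(\alpha)<\infty$, where $\rho_m(\alpha)=\frac{(m+|\alpha|-1)!}{\alpha!(m-1)!}$. $M_z=(M_{z_1},\ldots,M_{z_n})$ is the tuple of multiplications by the coordinate functions. Two tuples are unitarily equivalent if a single unitary operator intertwines them componentwise. *)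

(* Defs.v *)
From HB Require Import structures.
From mathcomp Require Import all_boot all_order all_algebra.
From mathcomp Require Import complex.
From mathcomp Require Import all_classical all_reals all_analysis.

Set Implicit Arguments.
Unset Strict Implicit.
Unset Printing Implicit Defensive.

Import Order.TTheory GRing.Theory Num.Theory.
Import numFieldNormedType.Exports.

Local Open Scope classical_set_scope.
Local Open Scope ring_scope.

(* The inner product is linear in its first argument; completeness and the
   topology are those of the underlying Banach space over the complex numbers. *)
HB.mixin Record CompleteNormedModule_isHilbert (R : realType) H
    & CompleteNormedModule R[i] H := {
  hdot : H -> H -> R[i];
  hdot_linearl : forall (a : R[i]) (x y z : H),
    hdot (a *: x + y) z = a * hdot x z + hdot y z;
  hdot_conj : forall x y : H, hdot y x = (hdot x y)^*;
  hdot_norm : forall x : H, hdot x x = `|x| ^+ 2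
}.

#[short(type="hilbertType")]
HB.structure Definition Hilbert (R : realType) :=
  { H of CompleteNormedModule R[i] H & CompleteNormedModule_isHilbert R H }.

Section operators.
Context (R : realType).
Local Notation C := R[i].

(* The library norm of a complex normed space takes its (nonnegative real)
   values in R[i]; this is the same number as an element of R. *)
Definition rnorm (V : normedModType C) (x : V) : R := complex.Re `|x|.

Definition enorm n (z : 'rV[C]_n) : R :=
  Num.sqrt (\sum_(i < n) rnorm (z ord0 i : C^o) ^+ 2).

Context (H : hilbertType R).

Definition orthogonal_compl (M : set H) : set H :=
  [set x | forall y, M y -> hdot x y = 0].

Definition orthogonal_proj (M : set H) (x : H) : H :=
  xget 0 [set y | M y /\ orthogonal_compl M (x - y)].

(* Existence for bounded A is the Riesz representation theorem. *)
Definition adjoint (A : H -> H) (y : H) : H :=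
  xget 0 [set z | forall x, hdot (A x) y = hdot x z].

Definition algebraic_direct_sum (M N : set H) : Prop :=
  (forall h, exists x y, [/\ M x, N y & h = x + y]) /\ M `&` N = [set 0].

Context (n : nat).

(* Elements of H^n are functions 'I_n -> H; this is the row operator H^n -> H
   of a tuple. *)
Definition row_op (T : 'I_n -> H -> H) (h : 'I_n -> H) : H :=
  \sum_(i < n) T i (h i).

Definition row_adj (T : 'I_n -> H -> H) (h : H) : 'I_n -> H :=
  fun i => adjoint (T i) h.

Definition scalar_tuple (z : 'rV[C]_n) : 'I_n -> H -> H :=
  fun i h => z ord0 i *: h.

Definition wandering (T : 'I_n -> H -> H) : set H :=
  orthogonal_compl (range (row_op T)).

Definition regular_at0 (T : 'I_n -> H -> H) : Prop :=
  closed (range (row_op T)) /\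
  exists2 eps : R, 0 < eps & forall z : 'rV[C]_n, enorm z < eps ->
    let TZ := range (fun h => row_op T h - row_op (scalar_tuple z) h) in
    closed TZ /\ algebraic_direct_sum TZ (wandering T).

(* Inverse of T^*T : Im T^* -> Im T^*; meaningful on Im T^* when T H^n is
   closed. *)
Definition TstarT_inv (T : 'I_n -> H -> H) (v : 'I_n -> H) : 'I_n -> H :=
  xget (fun=> 0)
    [set u | range (row_adj T) u /\ row_adj T (row_op T u) = v].

Definition sigma_op (T : 'I_n -> H -> H) (X : H -> H) : H -> H :=
  fun h => \sum_(i < n) T i (X (adjoint (T i) h)).

Definition Delta_op (m : nat) (T : 'I_n -> H -> H) : H -> H :=
  fun h => \sum_(j < m)
    ((-1) ^+ j * ('C(m, j.+1))%:R : C) *: iter j (sigma_op T) idfun h.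

Definition oplus (X : H -> H) (h : 'I_n -> H) : 'I_n -> H := fun i => X (h i).

Definition L_op (T : 'I_n -> H -> H) : 'I_n -> H -> H :=
  fun i x => TstarT_inv T (row_adj T x) i.

Local Notation mindex := {ffun 'I_n -> nat}.

Definition mdegree (a : mindex) : nat := \sum_(i < n) a i.

Definition mfactorial (a : mindex) : nat := \prod_(i < n) (a i)`!.

Definition tuple_pow (T : 'I_n -> H -> H) (a : mindex) : H -> H :=
  \big[comp/idfun]_(i < n) iter (a i) (T i).

Definition analytic_tuple (T : 'I_n -> H -> H) : Prop :=
  \bigcap_k [set x | exists h : mindex -> H,
    x = \sum_(a \in [set a : mindex | mdegree a = k]) tuple_pow T a (h a)]
  = [set 0].

Definition type_Cdot0 (T : 'I_n -> H -> H) : Prop :=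
  forall x : H, iter k (sigma_op T) idfun x @[k --> \oo] --> (0 : H).

Definition gamma (a : mindex) : C := ((mdegree a)`!)%:R / (mfactorial a)%:R.

End operators.

Section Hm_space.
Context (R : realType) (n : nat).
Local Notation C := R[i].
Local Notation mindex := {ffun 'I_n -> nat}.

Definition uball : Type := {z : 'rV[C]_n | enorm z < 1}.

Definition rho (m : nat) (a : mindex) : R :=
  ((m + mdegree a).-1`!)%:R / (mfactorial a * (m.-1)`!)%:R.

Definition monom (z : 'rV[C]_n) (a : mindex) : C :=
  \prod_(i < n) z ord0 i ^+ a i.

Context (E : hilbertType R).

(* f = sum_a c_a z^a on the ball, summed by homogeneous degree; this is how
   analytic functions on the ball are given, and f determines c. *)
Definition has_expansion (c : mindex -> E) (f : uball -> E) : Prop :=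
  forall z : uball,
    series (fun k => \sum_(a \in [set a : mindex | mdegree a = k])
                       monom (val z) a *: c a) @ \oo --> f z.

Definition coef_sqnorm (m : nat) (c : mindex -> E) : \bar R :=
  \esum_(a in [set: mindex]) (rnorm (c a) ^+ 2 / rho m a)%:E.

Definition Hm_sqnorm (m : nat) (f : uball -> E) : \bar R :=
  coef_sqnorm m (xget (fun=> 0) [set c | has_expansion c f]).

(* H_m(B, M) for a closed subspace M of E, whose elements are regarded as
   E-valued functions; M = setT gives H_m(B, E). *)
Definition Hm (m : nat) (M : set E) : set (uball -> E) :=
  [set f | exists c, [/\ forall a, M (c a), has_expansion c f
                       & (coef_sqnorm m c < +oo)%E]].

Definition Mz (i : 'I_n) (f : uball -> E) : uball -> E :=
  fun z => val z ord0 i *: f z.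

End Hm_space.

(* The unitary is a surjective linear isometry U : H -> H_m(B, D) with
   U T_i = M_{z_i} U. *)
Definition unitarily_equiv_Mz (R : realType) (H : hilbertType R) (n m : nat)
    (T : 'I_n -> H -> H) (D : hilbertType R) : Prop :=
  exists U : {linear H -> (uball R n -> D)},
    [/\ range U = Hm m [set: D],
        forall x, Hm_sqnorm m (U x) = (rnorm x ^+ 2)%:E
      & forall i x, U (T i x) = Mz i (U x)].

(* Main.v *)
Require Import Defs.
From HB Require Import structures.
From mathcomp Require Import all_boot all_order all_algebra.
From mathcomp Require Import complex.
From mathcomp Require Import all_classical all_reals all_analysis.
From mathcomp Require Import ring lra.
Set Implicit Arguments.
Unset Strict Implicit.
Unset Printing Implicit Defensive.
Import Order.TTheory GRing.Theory Num.Theory.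
Import numFieldNormedType.Exports.
Local Open Scope classical_set_scope.
Local Open Scope ring_scope.

(* Let P be the projection onto W = W(T), S_i = T_i^*, sigma = sigma_T and
   c_k = binom(m+k-1, k), so that sum_k c_k t^k = (1 - t)^(-m).  The identity
   on (T^*T)^(-1) says L_i = Delta S_i, hence TL = sigma(Delta) and
   (1 - sigma)^m (1) = P.
   Expanding (1 - ZL)^(-1) shows that regularity is equivalent to
   P (ZL)^(k+1) T_i = z_i P (ZL)^k.  Moving the T_i occurring in
   Delta = sum_j (-1)^j binom(m, j+1) sigma^j(1) to the left with this rule gives
   P (ZL)^k = c_k P (sum_i z_i S_i)^k and P S^a L_i = (c_(k+1) / c_k) P S^a S_i for
   |a| = k, so the coefficients gamma_a P L^a are the Q_a = rho_m(a) P S^a, and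
   Q_a T_i = Q_(a - e_i).  Therefore Q_a T^b w = delta_ab w on W: the vectors
   T^a w (w in W) of different multi-degrees are orthogonal with
   |T^a w|^2 = |w|^2 / rho_m(a), and x |-> sum_a (Q_a x) z^a is a partial isometry
   of H onto H_m(B, W) intertwining T and M_z.
   Each of (i) and (iii) makes this map injective, hence unitary: if all Q_a x
   vanish, then x = TLx, iterated, lies in every sum_(|a| = k) T^a H; and
   u_k = sigma^k(1) x satisfies (1 - shift)^m u = 0, which together with u -> 0 gives
   u = 0.  Conversely (ii), applied to the vectors S^b x, expresses
   <sigma^N(1) x, x> as sum_k c_k d_(k+N) <= sum_(k >= N) c_k d_k, a tail of the
   convergent series (ii) for x. *)

(** The obstacle is that [Delta_op m T] is not known to commute with T or with the adjoints, so
    (ZL)^k = (Delta K)^k, with K = sum_i z_i S_i, cannot be expanded directly. Only what remains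
    after P is applied on the left is accessible: there each T_i hidden in Delta is traded for a
    scalar z_i at the cost of one power of ZL, and the alternating sum that survives is the
    recursion of the coefficients of (1 - t)^(-m). This works for one z at a time; statements about
    single multi-indices are recovered because a homogeneous polynomial that vanishes on the ball
    has zero coefficients. Moreover [adjoint], [orthogonal_proj] and [TstarT_inv] are choices among
    the solutions of their defining equations, so solvability has to be established: by Riesz
    representation, by the projection theorem and, for T^*T u = T^*x with u in the range of T^*, by
    a lower bound for T^* on the closed range, which comes from uniform boundedness. *)

#[local] Notation cRe := complex.Re.
Local Notation "x %:C" := (real_complex _ x) : ring_scope.

(** * The real norm and the inner product *)

Section real_norm.
Context (R : realType).
Local Notation C := R[i].

Definition cabs (a : C) : R := cRe `|a|.

Lemma normcE_cabs (a : C) : `|a| = (cabs a)%:C.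
Proof. by rewrite /cabs RRe_real// ger0_real. Qed.

Lemma cReD (a b : C) : cRe (a + b) = cRe a + cRe b.
Proof. by case: a b => [? ?] []. Qed.

Lemma cReN (a : C) : cRe (- a) = - cRe a.
Proof. by case: a. Qed.

Lemma cReMr (a : R) (b : C) : cRe (a%:C * b) = a * cRe b.
Proof. by case: b => [? ?] /=; rewrite mul0r subr0. Qed.

Lemma cRe_sum I (r : seq I) (P : pred I) (F : I -> C) :
  cRe (\sum_(i <- r | P i) F i) = \sum_(i <- r | P i) cRe (F i).
Proof. exact: (big_morph _ cReD). Qed.

Lemma cabs_ge0 a : 0 <= cabs a.
Proof. by rewrite -ler0c -normcE_cabs. Qed.

Lemma cabsM a b : cabs (a * b) = cabs a * cabs b.
Proof.
by apply: (@complexI R); rewrite -normcE_cabs normrM !normcE_cabs rmorphM.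
Qed.

Lemma cabs_real (a : R) : 0 <= a -> cabs a%:C = a.
Proof. by move=> a0; rewrite /cabs ger0_norm// ler0c. Qed.

Lemma cabs_eq0 a : (cabs a == 0) = (a == 0).
Proof.
apply/eqP/eqP => [a0|->]; last by rewrite /cabs normr0.
by apply/eqP; rewrite -normr_eq0 normcE_cabs a0.
Qed.

Lemma Re_le_cabs a : cRe a <= cabs a.
Proof.
rewrite -lecR -normcE_cabs; apply: le_trans (normc_ge_Re a).
by rewrite lecR ler_norm.
Qed.

Section normedmod.
Context (V : normedModType C).
Implicit Types x y : V.

Lemma norm_rnorm x : `|x| = (rnorm x)%:C.
Proof. by rewrite /rnorm RRe_real// ger0_real. Qed.

Lemma rnorm_ge0 x : 0 <= rnorm x.
Proof. by rewrite -ler0c -norm_rnorm. Qed.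

Lemma rnormZ a x : rnorm (a *: x) = cabs a * rnorm x.
Proof.
by apply: (@complexI R); rewrite -norm_rnorm normrZ normcE_cabs norm_rnorm rmorphM.
Qed.

Lemma ler_rnormD x y : rnorm (x + y) <= rnorm x + rnorm y.
Proof. by have := ler_normD x y; rewrite !norm_rnorm -rmorphD lecR. Qed.

Lemma rnormN x : rnorm (- x) = rnorm x.
Proof. by rewrite /rnorm normrN. Qed.

Lemma rnorm0 : rnorm (0 : V) = 0.
Proof. by rewrite /rnorm normr0. Qed.

Lemma rnorm_eq0 x : (rnorm x == 0) = (x == 0).
Proof.
apply/eqP/eqP => [x0|->]; last exact: rnorm0.
by apply/eqP; rewrite -normr_eq0 norm_rnorm x0.
Qed.

Lemma rnorm_distC x y : rnorm (x - y) = rnorm (y - x).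
Proof. by rewrite -opprB rnormN. Qed.

Lemma ler_rnormB x y : rnorm (x - y) <= rnorm x + rnorm y.
Proof. by rewrite -(rnormN y) ler_rnormD. Qed.

Lemma rnorm_dist_triangle x y z : rnorm (x - z) <= rnorm (x - y) + rnorm (y - z).
Proof. by apply: le_trans (ler_rnormD _ _); rewrite addrA subrK. Qed.

Lemma ler_rnorm_sum I (r : seq I) (P : pred I) (F : I -> V) :
  rnorm (\sum_(i <- r | P i) F i) <= \sum_(i <- r | P i) rnorm (F i).
Proof.
elim/big_rec2: _ => [|i y x _ le]; first by rewrite rnorm0.
by apply: (le_trans (ler_rnormD _ _)); rewrite lerD2l.
Qed.

(** Positive elements of [R[i]] are real, so the complex-valued norm and real tolerances give the
    same neighbourhoods. *)
Lemma cvg_rnormP (u : nat -> V) (l : V) : u @ \oo --> l <->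
  forall e : R, 0 < e -> exists N, forall k, (N <= k)%N -> rnorm (u k - l) < e.
Proof.
split=> [/cvgrPdist_lt cu e e0|cu].
  have /cu[N _ NP] : 0 < e%:C by rewrite ltcR.
  exists N => k Nk; rewrite rnorm_distC -ltcR -norm_rnorm; exact: NP.
apply/cvgrPdist_lt => e e0.
have eR : e = (cRe e)%:C by rewrite RRe_real// gtr0_real.
have /cu[N NP] : 0 < cRe e by rewrite -ltcR -eR.
exists N => // k /= Nk; rewrite norm_rnorm eR ltcR rnorm_distC; exact: NP.
Qed.

Lemma rnorm_limit_unique (u : nat -> V) (l l' : V) :
  u @ \oo --> l -> u @ \oo --> l' -> l = l'.
Proof. exact: (@cvg_unique _ (@norm_hausdorff _ V)). Qed.

End normedmod.

Lemma cauchy_rnorm (V : completeNormedModType C) (u : nat -> V) :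
  (forall e : R, 0 < e -> exists N, forall i j, (N <= i)%N -> (N <= j)%N ->
     rnorm (u i - u j) < e) -> exists l : V, u @ \oo --> l.
Proof.
move=> cu; suff : cvg (u @ \oo) by move=> cvu; exists (lim (u @ \oo)).
apply: cauchy_cvg; apply: cauchy_exP => e e0.
have eR : e = (cRe e)%:C by rewrite RRe_real// gtr0_real.
have /cu[N NP] : 0 < cRe e by rewrite -ltcR -eR.
exists (u N); exists N => // k /= Nk.
by rewrite -ball_normE /= norm_rnorm eR ltcR NP.
Qed.

End real_norm.

Section hilbert.
Context (R : realType) (H : hilbertType R).
Local Notation C := R[i].
Implicit Types (x y z : H) (a : C).

Lemma hdotDl x y z : hdot (x + y) z = hdot x z + hdot y z.
Proof. by have := hdot_linearl 1 x y z; rewrite scale1r mul1r. Qed.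

Lemma hdot0l z : hdot 0 z = 0.
Proof. by apply: (addrI (hdot 0 z)); rewrite -hdotDl !addr0. Qed.

Lemma hdotZl a x z : hdot (a *: x) z = a * hdot x z.
Proof. by have := hdot_linearl a x 0 z; rewrite addr0 hdot0l addr0. Qed.

Lemma hdotNl x z : hdot (- x) z = - hdot x z.
Proof. by rewrite -scaleN1r hdotZl mulN1r. Qed.

Lemma hdotBl x y z : hdot (x - y) z = hdot x z - hdot y z.
Proof. by rewrite hdotDl hdotNl. Qed.

Lemma hdotDr x y z : hdot z (x + y) = hdot z x + hdot z y.
Proof. by rewrite hdot_conj hdotDl rmorphD /= -!hdot_conj. Qed.

Lemma hdotZr a x z : hdot z (a *: x) = a^* * hdot z x.
Proof. by rewrite hdot_conj hdotZl rmorphM /= -!hdot_conj. Qed.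

Lemma hdot0r z : hdot z 0 = 0.
Proof. by rewrite hdot_conj hdot0l rmorph0. Qed.

Lemma hdotNr x z : hdot z (- x) = - hdot z x.
Proof. by rewrite hdot_conj hdotNl rmorphN /= -hdot_conj. Qed.

Lemma hdotBr x y z : hdot z (x - y) = hdot z x - hdot z y.
Proof. by rewrite hdotDr hdotNr. Qed.

Lemma hdot_suml I (r : seq I) (P : pred I) (F : I -> H) z :
  hdot (\sum_(i <- r | P i) F i) z = \sum_(i <- r | P i) hdot (F i) z.
Proof. exact: (big_morph (hdot^~ z) (fun x y => hdotDl x y z) (hdot0l z)). Qed.

Lemma hdot_sumr I (r : seq I) (P : pred I) (F : I -> H) z :
  hdot z (\sum_(i <- r | P i) F i) = \sum_(i <- r | P i) hdot z (F i).
Proof. exact: (big_morph (hdot z) (fun x y => hdotDr x y z) (hdot0r z)). Qed.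

Lemma hdotxx x : hdot x x = (rnorm x ^+ 2)%:C.
Proof. by rewrite hdot_norm norm_rnorm rmorphXn. Qed.

Definition rdot x y : R := cRe (hdot x y).

Lemma rdotC x y : rdot x y = rdot y x.
Proof. by rewrite /rdot hdot_conj; case: (hdot y x). Qed.

Lemma rdotDl x y z : rdot (x + y) z = rdot x z + rdot y z.
Proof. by rewrite /rdot hdotDl cReD. Qed.

Lemma rdotDr x y z : rdot z (x + y) = rdot z x + rdot z y.
Proof. by rewrite /rdot hdotDr cReD. Qed.

Lemma rdotNl x y : rdot (- x) y = - rdot x y.
Proof. by rewrite /rdot hdotNl cReN. Qed.

Lemma rdotNr x y : rdot x (- y) = - rdot x y.
Proof. by rewrite /rdot hdotNr cReN. Qed.

Lemma rdotxx x : rdot x x = rnorm x ^+ 2.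
Proof. by rewrite /rdot hdotxx. Qed.

Lemma rdotZl (t : R) x y : rdot (t%:C *: x) y = t * rdot x y.
Proof. by rewrite /rdot hdotZl cReMr. Qed.

Lemma rdotZr (t : R) x y : rdot x (t%:C *: y) = t * rdot x y.
Proof. by rewrite rdotC rdotZl rdotC. Qed.

Lemma rnorm_sqrD x y : rnorm (x + y) ^+ 2 = rnorm x ^+ 2 + 2 * rdot x y + rnorm y ^+ 2.
Proof. by rewrite -!rdotxx rdotDl !rdotDr (rdotC y x); ring. Qed.

Lemma rnorm_sqrB x y : rnorm (x - y) ^+ 2 = rnorm x ^+ 2 - 2 * rdot x y + rnorm y ^+ 2.
Proof. by rewrite rnorm_sqrD rnormN rdotNr; ring. Qed.

Lemma hdot_rdot x y : hdot x y = (rdot x y +i* rdot x ('i%C *: y))%C.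
Proof.
rewrite /rdot hdotZr; case: (hdot x y) => a b /=.
by congr (_ +i* _)%C; ring.
Qed.

(** The imaginary part of the inner product is a real part at ['i *: y], so on a set stable under
    complex scalars real orthogonality suffices; the minimisation argument then needs only real
    parameters. *)
Lemma rdot_eq0_hdot x (N : set H) : (forall a y, N y -> N (a *: y)) ->
  (forall y, N y -> rdot x y = 0) -> forall y, N y -> hdot x y = 0.
Proof.
move=> NZ N0 y Ny; rewrite hdot_rdot N0// N0//; exact: NZ.
Qed.

Lemma hdot_ext x y : (forall z, hdot z x = hdot z y) -> x = y.
Proof.
move=> xy; apply/eqP; rewrite -subr_eq0 -rnorm_eq0 -sqrf_eq0.
by apply/eqP; rewrite -rdotxx /rdot hdotBr xy subrr.
Qed.

Lemma rdot_le x y : rdot x y <= rnorm x * rnorm y.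
Proof.
have [x0|x0] := eqVneq x 0.
  by rewrite x0 /rdot hdot0l rnorm0 mul0r.
have [y0|y0] := eqVneq y 0.
  by rewrite y0 /rdot hdot0r rnorm0 mulr0.
have p0 : 0 < rnorm x * rnorm y.
  by rewrite mulr_gt0// lt_neqAle eq_sym rnorm_eq0 rnorm_ge0 ?x0 ?y0.
(* Expanding the square of [|y| x - |x| y] gives the Cauchy-Schwarz inequality times the positive
   factor [2 |x| |y|]. *)
have := sqr_ge0 (rnorm ((rnorm y)%:C *: x - (rnorm x)%:C *: y)).
rewrite rnorm_sqrB rdotZl rdotZr !rnormZ !cabs_real ?rnorm_ge0//.
rewrite (_ : _ + _ = 2 * (rnorm x * rnorm y) * (rnorm x * rnorm y - rdot x y)); last by ring.
by rewrite pmulr_rge0 ?subr_ge0// mulr_gt0.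
Qed.

Lemma cabs_hdot_le x y : cabs (hdot x y) <= rnorm x * rnorm y.
Proof.
have [h0|h0] := eqVneq (hdot x y) 0.
  by rewrite h0 /cabs normr0 mulr_ge0 ?rnorm_ge0.
(* The phase that rotates [hdot x y] onto the nonnegative real axis. *)
pose a := (hdot x y)^* / `|hdot x y|.
have n0 : `|hdot x y| != 0 by rewrite normr_eq0.
have -> : cabs (hdot x y) = rdot (a *: x) y.
  rewrite /rdot hdotZl /a mulrAC (mulrC _^*) -normCK expr2 mulfK//.
apply: (le_trans (rdot_le _ _)); rewrite rnormZ.
suff -> : cabs a = 1 by rewrite mul1r.
by rewrite /cabs /a normrM normfV normr_id norm_conjC divff.
Qed.

Lemma hdot_cvg (u : nat -> H) x y : u @ \oo --> x ->
  forall e : R, 0 < e -> exists N, forall k, (N <= k)%N ->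
    cabs (hdot (u k) y - hdot x y) < e.
Proof.
move=> /cvg_rnormP ux e e0.
have y1 : 0 < rnorm y + 1 by rewrite ltr_wpDl ?rnorm_ge0.
have /ux[N NP] : 0 < e / (rnorm y + 1) by rewrite divr_gt0.
exists N => k /NP; rewrite ltr_pdivlMr// -hdotBl; apply: le_lt_trans.
apply: (le_trans (cabs_hdot_le _ _)); apply: ler_wpM2l; first exact: rnorm_ge0.
by rewrite lerDl.
Qed.

End hilbert.

(** * Orthogonal projection, Riesz representation and adjoints *)

Section projection.
Context (R : realType) (H : hilbertType R).
Local Notation C := R[i].
Implicit Types (x y z : H) (N : set H).

Lemma closed_rnormP N : closed N <->
  forall x, (forall e : R, 0 < e -> exists2 y, N y & rnorm (x - y) < e) -> N x.
Proof.
split=> [cN x xN|cN x xN].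
  apply: cN => B /nbhs_ballP[e /= e0 eB].
  have eR : e = (cRe e)%:C by rewrite RRe_real// gtr0_real.
  have /xN[y Ny xy] : 0 < cRe e by rewrite -ltcR -eR.
  exists y; split => //; apply: eB.
  by rewrite -ball_normE /= norm_rnorm eR ltcR.
apply: cN => e e0.
have /xN[y [Ny]] : nbhs x (ball x e%:C) by apply: nbhsx_ballx; rewrite ltcR.
rewrite -ball_normE /= norm_rnorm ltcR => xy; by exists y.
Qed.

Definition subspace_set N := N 0 /\ forall (a : C) x y, N x -> N y -> N (a *: x + y).

Lemma subspace_setZ N (a : C) x : subspace_set N -> N x -> N (a *: x).
Proof. by move=> [N0 NL] Nx; rewrite -[_ *: _]addr0; apply: NL. Qed.

Lemma subspace_setD N x y : subspace_set N -> N x -> N y -> N (x + y).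
Proof. by move=> [N0 NL] Nx Ny; rewrite -[x]scale1r; apply: NL. Qed.

Lemma subspace_setB N x y : subspace_set N -> N x -> N y -> N (x - y).
Proof. by move=> sN Nx Ny; rewrite addrC -scaleN1r; apply: sN.2. Qed.

Lemma subspace_orthogonal_compl N : subspace_set (orthogonal_compl N).
Proof.
split=> [y _|a x y xN yN z Nz]; first by rewrite hdot0l.
by rewrite hdotDl hdotZl xN// yN// mulr0 addr0.
Qed.

Lemma closed_orthogonal_compl N : closed (orthogonal_compl N).
Proof.
apply/closed_rnormP => x xN z Nz; apply/eqP; rewrite -cabs_eq0 eq_le cabs_ge0.
rewrite andbT leNgt; apply/negP => h0.
have z1 : 0 < rnorm z + 1 by rewrite ltr_wpDl ?rnorm_ge0.
have [|y Ny] := xN (cabs (hdot x z) / (rnorm z + 1)); first by rewrite divr_gt0.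
rewrite ltr_pdivlMr// ltNge => /negP; apply.
rewrite -[hdot x z]subr0 -(Ny _ Nz) -hdotBl.
apply: (le_trans (cabs_hdot_le _ _)); apply: ler_wpM2l; first exact: rnorm_ge0.
by rewrite lerDl.
Qed.

Lemma parallelogram x y :
  rnorm (x + y) ^+ 2 + rnorm (x - y) ^+ 2 = 2 * rnorm x ^+ 2 + 2 * rnorm y ^+ 2.
Proof. by rewrite rnorm_sqrB rnorm_sqrD; ring. Qed.

Lemma invSn_lt (e : R) : 0 < e -> exists N : nat, forall k, (N <= k)%N -> k.+1%:R^-1 < e.
Proof.
move=> e0; exists (Num.truncn e^-1) => k Nk.
rewrite -ltf_pV2 ?posrE ?invr_gt0// invrK.
apply: lt_le_trans (truncnS_gt _) _; by rewrite ler_nat.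
Qed.

Lemma orthogonal_decomposition N x : subspace_set N -> closed N ->
  exists2 p, N p & orthogonal_compl N (x - p).
Proof.
move=> sN cN; pose D := [set rnorm (x - y) ^+ 2 | y in N].
have D0 : has_inf D.
  split; first by exists (rnorm (x - 0) ^+ 2), 0 => //; exact: sN.1.
  by exists 0 => _ [y _ <-]; exact: sqr_ge0.
pose d := inf D.
have dle y : N y -> d <= rnorm (x - y) ^+ 2.
  by move=> Ny; apply: (ge_inf D0.2); exists y.
have /choice[u uP] : forall k : nat, exists y, N y /\ rnorm (x - y) ^+ 2 < d + k.+1%:R^-1.
  move=> k; have k0 : 0 < k.+1%:R^-1 :> R by rewrite invr_gt0.
  by have [_ [y Ny <-] yd] := inf_adherent k0 D0; exists y.
have uN k := (uP k).1.
(* The midpoint of [u i] and [u j] lies in [N], so its squared distance to [x] is at least [d]; the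
   parallelogram law then makes the minimising sequence Cauchy. *)
have du i j : rnorm (u i - u j) ^+ 2 <= 2 * i.+1%:R^-1 + 2 * j.+1%:R^-1.
  have := parallelogram (x - u i) (x - u j).
  rewrite (_ : x - u i + (x - u j) = 2%:R%:C *: (x - 2%:R^-1%:C *: (u i + u j))); last first.
    rewrite scalerBr scalerA -rmorphM divff// scale1r rmorph_nat scaler_nat mulr2n.
    by rewrite opprD addrACA.
  rewrite (_ : x - u i - (x - u j) = u j - u i); last first.
    by rewrite opprB addrACA [- u i + _]addrC addrACA subrr add0r.
  rewrite rnormZ cabs_real// (rnorm_distC (u j)) => E.
  have := dle _ (subspace_setZ 2%:R^-1%:C sN (subspace_setD sN (uN i) (uN j))).
  have := (uP i).2; have := (uP j).2; move: E; rewrite exprMn.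
  by move: (i.+1%:R^-1) (j.+1%:R^-1) => a b; lra.
have [p up] : exists p : H, u @ \oo --> p.
  apply: cauchy_rnorm => e e0.
  have [|M MP] := @invSn_lt (e ^+ 2 / 4); first by rewrite divr_gt0 ?exprn_gt0.
  exists M => i j Mi Mj; rewrite -(@ltr_pXn2r _ 2) ?nnegrE ?rnorm_ge0 ?ltW//.
  by have := du i j; have := MP _ Mi; have := MP _ Mj; move: (i.+1%:R^-1) (j.+1%:R^-1) => a b; lra.
have Np : N p.
  move/closed_rnormP : cN; apply=> e e0.
  by have /cvg_rnormP/(_ e e0)[M MP] := up; exists (u M) => //; rewrite rnorm_distC MP.
exists p => //; apply: rdot_eq0_hdot; first by move=> a y; exact: subspace_setZ.
move=> y Ny; apply/eqP/negPn/negP => r0.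
(* Variational inequality at an approximate minimiser: [t = r / |y|^2] is the optimal step along [y]
   and lowers the squared distance by [r^2 / |y|^2], which cannot exceed the gap [1 / (k + 1)]. *)
have ruk k : rdot (x - u k) y ^+ 2 <= rnorm y ^+ 2 * k.+1%:R^-1.
  have [y0|y0] := eqVneq (rnorm y) 0.
    move/eqP: y0; rewrite rnorm_eq0 => /eqP ->.
    by rewrite /rdot hdot0r rnorm0 /= !expr0n /= mul0r.
  have y2 : 0 < rnorm y ^+ 2 by rewrite exprn_gt0// lt_neqAle eq_sym y0 rnorm_ge0.
  set r := rdot _ _; pose t := r / rnorm y ^+ 2.
  have := dle _ (subspace_setD sN (uN k) (subspace_setZ t%:C sN Ny)).
  rewrite opprD addrA rnorm_sqrB rdotZr -/r rnormZ exprMn.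
  have -> : cabs t%:C ^+ 2 = t ^+ 2.
    by rewrite /cabs normc_def /= expr0n addr0 sqr_sqrtr// sqr_ge0.
  have := (uP k).2.
  rewrite (_ : _ - _ + _ = rnorm (x - u k) ^+ 2 - (rnorm y ^+ 2)^-1 * r ^+ 2).
    rewrite -ler_pdivrMl//; move: (k.+1%:R^-1) (_ * r ^+ 2) => a b h1 h2; lra.
  rewrite /t; field; by rewrite -sqrf_eq0 gt_eqF.
have [|M1 M1P] := hdot_cvg y up (e := `|rdot (x - p) y| / 2).
  by rewrite divr_gt0// normr_gt0.
(* With [a = rdot (x - p) y] and [b = rdot (u k - p) y] the two tolerances give
   [a^2 / 4 <= (a - b)^2 < a^2 / 4]. The summand 1 keeps the divisor positive when [y = 0]. *)
pose y1 := rnorm y ^+ 2 + 1.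
have y10 : 0 < y1 by rewrite ltr_wpDl// sqr_ge0.
have [|M2 M2P] := @invSn_lt (rdot (x - p) y ^+ 2 / 4 / y1).
  by rewrite !divr_gt0// exprn_even_gt0.
have := M1P _ (leq_maxl M1 M2); have := M2P _ (leq_maxr M1 M2).
set k := maxn _ _ => k2 k1; have := ruk k.
have : `|rdot (u k - p) y| < `|rdot (x - p) y| / 2.
  apply: le_lt_trans k1; rewrite -hdotBl ler_norml Re_le_cabs andbT.
  rewrite lerNl -cReN -hdotNl; apply: le_trans (Re_le_cabs _) _.
  by rewrite hdotNl /cabs normrN.
have -> : rdot (x - u k) y = rdot (x - p) y - rdot (u k - p) y.
  by rewrite -rdotNl -rdotDl opprB addrA subrK.
move: k2; rewrite ltr_pdivlMr// /y1.
have v0 : 0 < k.+1%:R^-1 :> R by rewrite invr_gt0.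
move: v0; set v := _^-1; set a := rdot (x - p) y; set b := rdot (u k - p) y => v0.
have := sqr_ge0 (rnorm y); set Y := rnorm y ^+ 2 => Y0 h1 h2 h3.
have h4 : b ^+ 2 <= a ^+ 2 / 4.
  rewrite -[b ^+ 2]real_normK ?num_real// -[a ^+ 2]real_normK ?num_real//.
  have -> : `|a| ^+ 2 / 4 = (`|a| / 2) ^+ 2 by field.
  by rewrite ler_sqr ?nnegrE ?divr_ge0//; exact: ltW.
have h5 : a ^+ 2 / 4 <= (a - b) ^+ 2.
  rewrite -[(a - b) ^+ 2]real_normK ?num_real// -[a ^+ 2]real_normK ?num_real//.
  have -> : `|a| ^+ 2 / 4 = (`|a| / 2) ^+ 2 by field.
  rewrite ler_sqr ?nnegrE ?divr_ge0//.
  by have := lerB_dist a b; lra.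
nra.
Qed.

Lemma riesz (phi : H -> C) (M : R) : (forall a x y, phi (a *: x + y) = a * phi x + phi y) ->
  (forall x, cabs (phi x) <= M * rnorm x) -> exists z, forall x, phi x = hdot x z.
Proof.
move=> phiL phiM.
have phiZ a x : phi (a *: x) = a * phi x.
  have phi0 : phi 0 = 0.
    by apply: (addrI (phi 0)); rewrite addr0 -{1}[phi 0]mul1r -phiL scale1r addr0.
  by rewrite -[a *: x]addr0 phiL phi0 addr0.
have [phi0|] := pselect (forall x, phi x = 0).
  by exists 0 => x; rewrite hdot0r.
move/existsNP => [x0 /eqP px0].
pose N := [set x | phi x = 0].
have sN : subspace_set N.
  split=> [|a x y]; rewrite /N /=; first by rewrite -(scale0r 0) phiZ mul0r.
  by move=> Nx Ny; rewrite phiL Nx Ny mulr0 addr0.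
have phiB x y : phi (x - y) = phi x - phi y.
  by rewrite addrC -scaleN1r phiL mulN1r addrC.
have cN : closed N.
  apply/closed_rnormP => x xN; apply/eqP; rewrite -cabs_eq0 eq_le cabs_ge0.
  rewrite andbT leNgt; apply/negP => h0.
  have M1 : 0 < `|M| + 1 by rewrite ltr_wpDl.
  have [|y Ny] := xN (cabs (phi x) / (`|M| + 1)); first by rewrite divr_gt0.
  rewrite ltr_pdivlMr// ltNge => /negP; apply.
  rewrite -[phi x]subr0 -Ny -phiB; apply: (le_trans (phiM _)).
  rewrite mulrC ler_wpM2l ?rnorm_ge0//; by rewrite (le_trans (ler_norm M))// lerDl.
have [p Np qN] := orthogonal_decomposition x0 sN cN.
set q := x0 - p in qN.
have pq : phi q != 0 by rewrite phiB Np subr0.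
have q0 : hdot q q != 0.
  apply: contra pq => /eqP; rewrite hdotxx => /(@complexI R _ 0) /eqP.
  by rewrite sqrf_eq0 rnorm_eq0 => /eqP ->; rewrite -(scale0r 0) phiZ mul0r.
(* [q] spans the complement of the kernel: [x - (phi x / phi q) q] lies in the kernel, hence is
   orthogonal to [q]. The conjugate compensates for the antilinear second argument. *)
exists ((phi q / hdot q q)^* *: q) => x; rewrite hdotZr conjCK.
have /qN : N (x - (phi x / phi q) *: q).
  by rewrite /N /= phiB phiZ divfK// subrr.
rewrite hdot_conj hdotBl hdotZl => /(congr1 Num.conj); rewrite conjCK conjC0.
move/eqP; rewrite subr_eq0 => /eqP ->; rewrite mulrACA mulVf// mulr1 mulrC.
by rewrite divfK.
Qed.

End projection.

Section bounded_operators.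
Context (R : realType) (H : hilbertType R).
Local Notation C := R[i].
Implicit Types (x y z : H) (f g : H -> H).

(** A predicate on plain functions, because [adjoint], [sigma_op], [Delta_op] and [tuple_pow]
    produce functions that carry no linear structure. *)
Definition bounded_op f := linear f /\
  exists2 M : R, 0 <= M & forall x, rnorm (f x) <= M * rnorm x.

Lemma bounded_opD f x y : bounded_op f -> f (x + y) = f x + f y.
Proof. by move=> [fL _]; have := fL 1 x y; rewrite !scale1r. Qed.

Lemma bounded_op0 f : bounded_op f -> f 0 = 0.
Proof. by move=> bf; apply: (addrI (f 0)); rewrite -bounded_opD// !addr0. Qed.

Lemma bounded_opZ f (a : C) x : bounded_op f -> f (a *: x) = a *: f x.
Proof. by move=> bf; rewrite -[a *: x]addr0 bf.1 bounded_op0// addr0. Qed.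

Lemma bounded_opN f x : bounded_op f -> f (- x) = - f x.
Proof. by move=> bf; rewrite -scaleN1r bounded_opZ// scaleN1r. Qed.

Lemma bounded_opB f x y : bounded_op f -> f (x - y) = f x - f y.
Proof. by move=> bf; rewrite bounded_opD// bounded_opN. Qed.

Lemma bounded_op_sum f I (r : seq I) (P : pred I) (F : I -> H) : bounded_op f ->
  f (\sum_(i <- r | P i) F i) = \sum_(i <- r | P i) f (F i).
Proof.
by move=> bf; apply: (big_morph f) => [x y|]; [exact: bounded_opD|exact: bounded_op0].
Qed.

Lemma bounded_op_cvg f (u : nat -> H) x : bounded_op f -> u @ \oo --> x ->
  (f \o u) @ \oo --> f x.
Proof.
move=> bf /cvg_rnormP ux; apply/cvg_rnormP => e e0.
have [M M0 fM] := bf.2.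
have M1 : 0 < M + 1 by rewrite ltr_wpDl.
have [|N NP] := ux (e / (M + 1)); first by rewrite divr_gt0.
exists N => k /NP; rewrite ltr_pdivlMr// /= -bounded_opB//; apply: le_lt_trans.
by apply: (le_trans (fM _)); rewrite mulrC ler_wpM2l ?rnorm_ge0// lerDl.
Qed.

Lemma bounded_op_idfun : bounded_op idfun.
Proof. by split=> //; exists 1 => // x; rewrite mul1r. Qed.

Lemma bounded_op_comp f g : bounded_op f -> bounded_op g -> bounded_op (f \o g).
Proof.
move=> bf bg; split=> [a x y|]; first by rewrite /= bg.1 bf.1.
have [[M M0 fM] [N N0 gN]] := (bf.2, bg.2).
exists (M * N) => [|x]; first exact: mulr_ge0.
by apply: (le_trans (fM _)); rewrite -mulrA ler_wpM2l.
Qed.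

Lemma bounded_op_zero : bounded_op (fun=> 0).
Proof.
by split=> [a x y|]; [rewrite scaler0 addr0|exists 0 => // x; rewrite rnorm0 mul0r].
Qed.

Lemma bounded_op_add f g : bounded_op f -> bounded_op g ->
  bounded_op (fun x => f x + g x).
Proof.
move=> bf bg; split=> [a x y|]; first by rewrite bg.1 bf.1 scalerDr addrACA.
have [[M M0 fM] [N N0 gN]] := (bf.2, bg.2).
exists (M + N) => [|x]; first exact: addr_ge0.
by apply: (le_trans (ler_rnormD _ _)); rewrite mulrDl lerD.
Qed.

Lemma bounded_op_scale f (a : C) : bounded_op f -> bounded_op (fun x => a *: f x).
Proof.
move=> bf; split=> [b x y|].
  by rewrite bf.1 scalerDr !scalerA mulrC.
have [M M0 fM] := bf.2.
exists (cabs a * M) => [|x]; first by rewrite mulr_ge0 ?cabs_ge0.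
by rewrite rnormZ -mulrA ler_wpM2l ?cabs_ge0.
Qed.

Lemma bounded_op_bigsum I (r : seq I) (F : I -> H -> H) :
  (forall i, bounded_op (F i)) -> bounded_op (fun x => \sum_(i <- r) F i x).
Proof.
move=> bF; elim: r => [|i r IH].
  rewrite (_ : (fun _ => _) = fun=> 0); first exact: bounded_op_zero.
  by apply/funext => x; rewrite big_nil.
rewrite (_ : (fun _ => _) = fun x => F i x + \sum_(j <- r) F j x).
  exact: bounded_op_add.
by apply/funext => x; rewrite big_cons.
Qed.

Lemma continuous_bounded_op (f : {linear H -> H}) : continuous f -> bounded_op f.
Proof.
move=> cf; split; first exact: linearP.
have /linear_boundedP[M [Mr MP]] : bounded_near f (nbhs (0 : H)).
  exact/continuous_linear_bounded/cf.
pose K := `|M| + 1.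
have KR : K = (cRe K)%:C by rewrite RRe_real// ger0_real// addr_ge0.
have MK : M < K.
  by rewrite /K (le_lt_trans (real_ler_norm Mr))// ltrDl.
exists (cRe K) => [|x]; first by rewrite -ler0c -KR addr_ge0.
by rewrite -lecR rmorphM /= -KR -!norm_rnorm; exact: MP.
Qed.

Lemma adjointP f x y : bounded_op f -> hdot (f x) y = hdot x (adjoint f y).
Proof.
move=> bf; have [M M0 fM] := bf.2.
have [z zP] : exists z, forall x, hdot (f x) y = hdot x z.
  apply: (riesz (phi := fun x => hdot (f x) y) (M := M * rnorm y)) => [a u v|u].
    by rewrite bf.1 hdotDl hdotZl.
  apply: (le_trans (cabs_hdot_le _ _)).
  by rewrite mulrAC ler_wpM2r ?rnorm_ge0.
rewrite /adjoint; case: xgetP => [w -> /(_ x)//|/(_ z)]; by case.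
Qed.

Lemma adjointP' f x y : bounded_op f -> hdot x (f y) = hdot (adjoint f x) y.
Proof. by move=> bf; rewrite hdot_conj adjointP// -hdot_conj. Qed.

Lemma bounded_op_adjoint f : bounded_op f -> bounded_op (adjoint f).
Proof.
move=> bf; split=> [a x y|].
  by apply: hdot_ext => z; rewrite -adjointP// !hdotDr !hdotZr -!adjointP.
have [M M0 fM] := bf.2; exists M => // y.
have [->|y0] := eqVneq (adjoint f y) 0; first by rewrite rnorm0 mulr_ge0 ?rnorm_ge0.
have p0 : 0 < rnorm (adjoint f y) by rewrite lt_neqAle rnorm_ge0 eq_sym rnorm_eq0 y0.
(* [|f^* y|^2 = <f f^* y, y> <= M |f^* y| |y|], divided by [|f^* y|]: the bound of [f] serves its
   adjoint. *)
rewrite -(ler_pM2l p0) -expr2 -rdotxx /rdot -adjointP//.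
apply: (le_trans (rdot_le _ _)).
by rewrite mulrCA mulrA ler_wpM2r ?rnorm_ge0.
Qed.

End bounded_operators.

(** * Row operators with closed range *)

Section closed_range.
Context (R : realType) (H : hilbertType R).
Local Notation C := R[i].
Implicit Types (x y z : H).

(** For [v] along [y] with [|v| = r], the pairings of [x + v] and [x - v] with [y] differ by
    [2 <v, y>], of modulus [2 r |y|], so one of them has modulus at least [r |y|]. *)
Lemma exists_step (r : R) x y : 0 <= r -> exists x' : H,
  rnorm (x' - x) <= r /\ r * rnorm y <= cabs (hdot x' y).
Proof.
move=> r0; have [->|y0] := eqVneq y 0.
  by exists x; rewrite subrr !rnorm0 mulr0 cabs_ge0.
have yn : rnorm y != 0 by rewrite rnorm_eq0.
pose v := (r / rnorm y)%:C *: y.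
have t0 : 0 <= r / rnorm y by rewrite divr_ge0 ?rnorm_ge0.
have nv : rnorm v = r by rewrite rnormZ cabs_real// divfK.
have vy : cabs (hdot v y) = r * rnorm y.
  rewrite hdotZl hdotxx cabsM !cabs_real ?exprn_ge0 ?rnorm_ge0//.
  by rewrite expr2 mulrA divfK.
have : 2 * (r * rnorm y) <= cabs (hdot (x + v) y) + cabs (hdot (x - v) y).
  rewrite -vy mulr2n mulrDl !mul1r -lecR !rmorphD /= -!normcE_cabs.
  have -> : `|hdot v y| + `|hdot v y| = `|hdot (x + v) y - hdot (x - v) y|.
    rewrite -hdotBl (_ : x + v - _ = v + v); last by rewrite opprB addrC addrA subrK.
    by rewrite hdotDl -!mulr2n normrMn.
  by rewrite ler_normB.
have [le1 _|lt1 le2] := leP (r * rnorm y) (cabs (hdot (x + v) y)).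
  by exists (x + v); rewrite addrC addKr nv.
by exists (x - v); rewrite addrC addKr rnormN nv; split => //; lra.
Qed.

(* Sokal's proof of the uniform boundedness principle, for the functionals
   [hdot ^~ y]. *)
Lemma uniform_boundedness (P : set H) :
  (forall x, exists K : R, forall y, P y -> cabs (hdot x y) <= K) ->
  exists K : R, forall y, P y -> rnorm y <= K.
Proof.
move=> Pb; apply: contrapT => /forallNP nb.
(* The step of radius [3^-k] makes the pairing with [y k] at least [3^-k |y k|], and all later steps
   together change it by at most half of that. The limit thus pairs with [y k] to at least
   [3^-k |y k| / 2], which this threshold makes larger than [k]. *)
have {nb}/choice[y yP] : forall k : nat, exists y, P y /\ k%:R * 2 * 3 ^+ k < rnorm y.
  move=> k; have /existsNP[y /not_implyP[Py /negP]] := nb (k%:R * 2 * 3 ^+ k).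
  by rewrite -ltNge => ?; exists y.
have [w wE] : exists w : nat -> R, forall k, w k = 3 ^- k by exists (fun k => 3 ^- k).
have w0 k : 0 <= w k by rewrite wE invr_ge0 exprn_ge0.
have /choice[step stepP] : forall p : nat * H, exists x' : H,
    rnorm (x' - p.2) <= w p.1 /\ w p.1 * rnorm (y p.1) <= cabs (hdot x' (y p.1)).
  by move=> [k x] /=; exact: exists_step.
pose u := fix u k := if k is j.+1 then step (j, u j) else 0.
have w3 k : w k.+1 = w k / 3 by rewrite !wE exprSr invfM.
have du j i : rnorm (u (i + j)%N - u j) <= 3 / 2 * (w j - w (i + j)%N).
  elim: i => [|i IH]; first by rewrite add0n !subrr rnorm0 mulr0.
  apply: (le_trans (rnorm_dist_triangle _ (u (i + j)%N) _)).
  have := (stepP ((i + j)%N, u (i + j)%N)).1; rewrite -[step _]/(u (i + j).+1) /=.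
  rewrite addSn w3; move: IH; move: (rnorm _) (rnorm _) (w _) (w _) => a b c d.
  move=> h1 h2; lra.
have du' j i : (j <= i)%N -> rnorm (u i - u j) <= 3 / 2 * w j.
  move=> ji; rewrite -(subnK ji); apply: (le_trans (du _ _)).
  by rewrite ler_wpM2l// gerBl.
have w_lt (e : R) : 0 < e -> exists N, w N < e.
  move=> e0; have [N NP] := invSn_lt e0.
  exists N; apply: le_lt_trans (NP N (leqnn _)); rewrite wE lef_pV2 ?posrE ?exprn_gt0//.
  by rewrite -natrX ler_nat ltn_expl.
have [l ul] : exists l : H, u @ \oo --> l.
  apply: cauchy_rnorm => e e0.
  have [|N NP] := w_lt (e / 3); first by rewrite divr_gt0.
  exists N => i j Ni Nj.
  apply: (le_lt_trans (rnorm_dist_triangle _ (u N) _)).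
  have := du' _ _ Ni; have := du' _ _ Nj; rewrite (rnorm_distC (u N) (u j)); lra.
have lu j : rnorm (l - u j.+1) <= 2^-1 * w j.
  apply/ler_addgt0Pr => e e0.
  have /cvg_rnormP/(_ e e0)[N NP] := ul.
  apply: (le_trans (rnorm_dist_triangle _ (u (maxn N j.+1)) _)).
  have := NP _ (leq_maxl N j.+1); rewrite (rnorm_distC _ l).
  have := du' _ _ (leq_maxr N j.+1); rewrite w3; lra.
have [K KP] := Pb l.
have big (k : nat) : k%:R < cabs (hdot l (y k)).
  have [_] := stepP (k, u k); rewrite -[step _]/(u k.+1) /= => s1.
  have [_ yk] := yP k.
  have := cabs_hdot_le (l - u k.+1) (y k).
  have : cabs (hdot (u k.+1) (y k)) <= cabs (hdot l (y k)) + cabs (hdot (l - u k.+1) (y k)).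
    rewrite -lecR rmorphD /= -!normcE_cabs hdotBl.
    by rewrite -[X in `|X| <= _](subKr (hdot l (y k))) ler_normB.
  have l1 := ler_wpM2r (rnorm_ge0 (y k)) (lu k).
  have : k%:R * 2 < w k * rnorm (y k).
    by rewrite wE ltr_pdivlMl ?exprn_gt0// mulrC.
  lra.
have := big (Num.truncn K).+1; have := KP _ (yP (Num.truncn K).+1).1.
have := truncnS_gt K; lra.
Qed.

Context (n : nat) (T : 'I_n -> H -> H).
Hypothesis bT : forall i, bounded_op (T i).
Hypothesis cT : closed (range (row_op T)).
Local Notation Tadj i := (adjoint (T i)).

Lemma subspace_row_range : subspace_set (range (row_op T)).
Proof.
split=> [|a x y [h _ <-] [k _ <-]].
  by exists (fun=> 0) => //; rewrite /row_op big1// => i _; rewrite bounded_op0.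
exists (fun i => a *: h i + k i) => //; rewrite /row_op scaler_sumr -big_split.
by apply: eq_bigr => i _ /=; rewrite (bT i).1.
Qed.

Lemma hdot_row_op h y : hdot (row_op T h) y = \sum_(i < n) hdot (h i) (Tadj i y).
Proof. by rewrite /row_op hdot_suml; apply: eq_bigr => i _; rewrite adjointP. Qed.

Lemma wanderingP x : wandering T x <-> forall i, Tadj i x = 0.
Proof.
split=> [xW i|x0 _ [h _ <-]].
  apply: hdot_ext => z; rewrite hdot0r -adjointP// hdot_conj.
  have -> : T i z = row_op T (fun j => if j == i then z else 0).
    rewrite /row_op (bigD1 i)//= eqxx big1 ?addr0// => j /negPf ->.
    by rewrite bounded_op0.
  by rewrite xW ?conjC0//; eexists.
by rewrite hdot_conj hdot_row_op big1 ?conjC0// => i _; rewrite x0 hdot0r.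
Qed.

Local Notation tn y := (\sum_(i < n) rnorm (Tadj i y)).

(** Plays the part of the open mapping theorem. A vector [x] pairs with [y] in the range only
    through its projection [row_op T h], hence boundedly when [tn y <= 1]; uniform boundedness then
    bounds all such [y]. *)
Lemma row_adj_bounded_below : exists2 K : R, 0 <= K &
  forall y, range (row_op T) y -> rnorm y <= K * tn y.
Proof.
have tn0 y : 0 <= tn y by apply: sumr_ge0 => i _; exact: rnorm_ge0.
have dle h y : cabs (hdot (row_op T h) y) <= (\sum_(i < n) rnorm (h i)) * tn y.
  rewrite hdot_row_op mulr_suml.
  have : `|\sum_(i < n) hdot (h i) (Tadj i y)| <=
      (\sum_(i < n) rnorm (h i) * rnorm (Tadj i y))%:C.
    apply: (le_trans (ler_norm_sum _ _ _)); rewrite rmorph_sum /=.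
    by apply: ler_sum => i _; rewrite normcE_cabs lecR cabs_hdot_le.
  rewrite normcE_cabs lecR => /le_trans; apply; apply: ler_sum => i _.
  rewrite ler_wpM2l ?rnorm_ge0// (bigD1 i)//= lerDl.
  by apply: sumr_ge0 => j _; exact: rnorm_ge0.
pose P := [set y | range (row_op T) y /\ tn y <= 1].
have [x|K KP] := @uniform_boundedness P.
  have [_ [h _ <-] hx] := orthogonal_decomposition x subspace_row_range cT.
  exists (\sum_(i < n) rnorm (h i)) => y [yM y1].
  rewrite -[x](subrK (row_op T h)) hdotDl hx// add0r.
  apply: (le_trans (dle _ _)); rewrite ler_piMr//.
  by apply: sumr_ge0 => j _; exact: rnorm_ge0.
exists `|K| => // y yM; have [t0|t0] := eqVneq (tn y) 0.
  move: (yM) => [h _ hy]; have := dle h y; rewrite t0 hy hdotxx mulr0.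
  rewrite cabs_real ?sqr_ge0// => y0.
  suff : rnorm y == 0 by move=> /eqP ->; rewrite mulr0.
  by rewrite -sqrf_eq0 eq_le y0 sqr_ge0.
have tp : 0 < tn y by rewrite lt_neqAle eq_sym t0 tn0.
have : P ((tn y)^-1%:C *: y).
  split; first exact: subspace_setZ subspace_row_range yM.
  rewrite (eq_bigr (fun i => (tn y)^-1 * rnorm (Tadj i y))) => [|i _].
    by rewrite -mulr_sumr mulVf.
  by rewrite bounded_opZ ?rnormZ ?cabs_real ?invr_ge0//; exact: bounded_op_adjoint.
move=> /KP; rewrite rnormZ cabs_real ?invr_ge0// mulrC ler_pdivrMr// => /le_trans.
by apply; rewrite ler_wpM2r// ler_norm.
Qed.

Local Notation G x := (row_op T (row_adj T x)).

Lemma bounded_op_row_square : bounded_op (fun x => G x).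
Proof.
by apply: bounded_op_bigsum => i; apply: bounded_op_comp => //; exact: bounded_op_adjoint.
Qed.

Lemma hdot_row_square x : hdot (G x) x = (\sum_(i < n) rnorm (Tadj i x) ^+ 2)%:C.
Proof. by rewrite hdot_row_op rmorph_sum; apply: eq_bigr => i _; exact: hdotxx. Qed.

Lemma row_square_eq0 x : hdot (G x) x = 0 -> wandering T x.
Proof.
rewrite hdot_row_square => /(@complexI R _ 0)/eqP.
rewrite psumr_eq0 => [/allP x0|i _]; last exact: sqr_ge0.
apply/wanderingP => i; apply/eqP; rewrite -rnorm_eq0 -sqrf_eq0.
by apply: x0; rewrite mem_index_enum.
Qed.

(** [<G y, y>] is the sum of the [|T_i^* y|^2], which controls the square of [tn y] up to the factor
    [n] by convexity; hence the [n%:R] in the constant. *)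
Lemma row_square_bounded_below : exists2 K : R, 0 <= K &
  forall y, range (row_op T) y -> rnorm y <= K * rnorm (G y).
Proof.
have [K K0 KP] := row_adj_bounded_below.
exists (K ^+ 2 * n%:R) => [|y yM]; first by rewrite mulr_ge0 ?sqr_ge0.
have [->|y0] := eqVneq y 0.
  by rewrite rnorm0 !mulr_ge0 ?sqr_ge0 ?rnorm_ge0.
have yp : 0 < rnorm y by rewrite lt_neqAle eq_sym rnorm_eq0 y0 rnorm_ge0.
rewrite -(ler_pM2r yp) -expr2.
have tp : 0 <= tn y by apply: sumr_ge0 => i _; exact: rnorm_ge0.
have : rnorm y ^+ 2 <= (K * tn y) ^+ 2.
  by rewrite ler_sqr ?nnegrE ?rnorm_ge0 ?mulr_ge0// KP.
move=> /le_trans; apply; rewrite exprMn.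
rewrite (_ : _ * rnorm y = K ^+ 2 * (n%:R * (rnorm (G y) * rnorm y))); last by rewrite !mulrA.
apply: ler_wpM2l; first exact: sqr_ge0.
apply: (@le_trans _ _ (n%:R * \sum_(i < n) rnorm (Tadj i y) ^+ 2)); last first.
  rewrite ler_wpM2l//; apply: le_trans (rdot_le _ _).
  by rewrite /rdot hdot_row_square.
rewrite expr2 big_distrlr /=.
have -> : n%:R * (\sum_(i < n) rnorm (Tadj i y) ^+ 2) =
    \sum_(i < n) \sum_(j < n) ((rnorm (Tadj i y) ^+ 2 + rnorm (Tadj j y) ^+ 2) / 2).
  under [RHS]eq_bigr do under eq_bigr do rewrite mulrDl.
  under [RHS]eq_bigr do rewrite big_split /=.
  rewrite big_split /= [X in _ + X]exchange_big /= -big_split /= mulr_sumr.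
  have sum_cst (c : R) : \sum_(j < n) c = n%:R * c by rewrite sumr_const card_ord mulr_natl.
  apply: eq_bigr => i _; rewrite !sum_cst -mulrDr.
  by congr (_ * _); field.
apply: ler_sum => i _; apply: ler_sum => j _.
have := sqr_ge0 (rnorm (Tadj i y) - rnorm (Tadj j y)); nra.
Qed.

(** [G] annihilates the wandering subspace, so approximate preimages can be projected into the range
    of [row_op T]; there [G] is bounded below and they form a Cauchy sequence. *)
Lemma closed_row_square_range : closed (range (fun x => G x)).
Proof.
have [K K0 KP] := row_square_bounded_below.
have bG := bounded_op_row_square.
apply/closed_rnormP => x xG.
have /choice[g gP] : forall k : nat, exists g, range (row_op T) g /\ rnorm (x - G g) < k.+1%:R^-1.
  move=> k; have [|_ [h _ <-] xh] := xG k.+1%:R^-1; first by rewrite invr_gt0.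
  have [p pM hp] := orthogonal_decomposition h subspace_row_range cT.
  exists p; split => //; suff -> : G p = G h by [].
  have /wanderingP w0 : wandering T (h - p) by [].
  rewrite -[h in RHS](subrK p) (bounded_opD (f := fun x => G x))//.
  rewrite -[LHS]add0r; congr (_ + _); rewrite /row_op big1// => i _.
  by rewrite /row_adj w0 bounded_op0.
have Gx : (fun k => G (g k)) @ \oo --> x.
  apply/cvg_rnormP => e e0; have [N NP] := invSn_lt e0.
  by exists N => k Nk; rewrite rnorm_distC; exact: lt_trans (gP k).2 (NP k Nk).
have [l gl] : exists l : H, g @ \oo --> l.
  apply: cauchy_rnorm => e e0.
  have K1 : 0 < K + 1 by rewrite ltr_wpDl.
  have [|N NP] := @invSn_lt _ (e / (K + 1) / 2); first by rewrite !divr_gt0.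
  exists N => i j Ni Nj.
  have gij : range (row_op T) (g i - g j).
    by apply: subspace_setB subspace_row_range _ _; [exact: (gP i).1|exact: (gP j).1].
  apply: (le_lt_trans (KP _ gij)).
  rewrite (bounded_opB (f := fun x => G x))//.
  have : rnorm (G (g i) - G (g j)) < e / (K + 1).
    apply: (le_lt_trans (rnorm_dist_triangle _ x _)); rewrite (rnorm_distC _ x).
    have := lt_trans (gP i).2 (NP i Ni); have := lt_trans (gP j).2 (NP j Nj).
    by move: (e / (K + 1)) => a; lra.
  rewrite ltr_pdivlMr// mulrC; apply: le_lt_trans.
  by rewrite ler_wpM2r ?rnorm_ge0// lerDl.
exists l => //; apply: rnorm_limit_unique Gx.
exact: (bounded_op_cvg bG gl).
Qed.

(** Shows that the choice in [TstarT_inv] has a solution. With [G g] the projection of [x] onto the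
    closed range of [G], the residue [r = x - G g] satisfies [<G r, r> = 0], hence is killed by all
    adjoints, and [row_adj T g] is the preimage. *)
Lemma TstarT_invP x : range (row_adj T) (TstarT_inv T (row_adj T x)) /\
  row_adj T (row_op T (TstarT_inv T (row_adj T x))) = row_adj T x.
Proof.
have bG := bounded_op_row_square.
have sG : subspace_set (range (fun x => G x)).
  split; first by exists 0 => //; exact: (bounded_op0 bG).
  move=> a _ _ [u _ <-] [v _ <-]; exists (a *: u + v) => //; exact: bG.1.
have [_ [g _ <-] gx] := orthogonal_decomposition x sG closed_row_square_range.
have /wanderingP w0 : wandering T (x - G g).
  by apply: row_square_eq0; rewrite hdot_conj gx ?conjC0//; exists (x - G g).
rewrite /TstarT_inv; case: xgetP => [u ->//|/(_ (row_adj T g))[]].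
split; first by exists g.
apply/funext => i; have := w0 i; rewrite bounded_opB; last exact: bounded_op_adjoint.
by move/eqP; rewrite subr_eq0 => /eqP.
Qed.

Lemma orthogonal_projP x : wandering T (x - row_op T (fun i => L_op T i x)) /\
  orthogonal_proj (wandering T) x = x - row_op T (fun i => L_op T i x).
Proof.
set p := x - _; have [_ E] := TstarT_invP x.
have pW : wandering T p.
  apply/wanderingP => i; rewrite bounded_opB; last exact: bounded_op_adjoint.
  apply/eqP; rewrite subr_eq0; apply/eqP; exact: esym (congr1 (fun h => h i) E).
have xp : orthogonal_compl (wandering T) (x - p).
  move=> y yW; rewrite /p opprB addrC subrK hdot_conj yW ?conjC0//; by eexists.
split => //; rewrite /orthogonal_proj; case: xgetP => [q _ [qW xq]|/(_ p)[]//].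
(* The difference of two candidates for the projection lies in [wandering T] and is orthogonal to
   it. *)
apply/eqP; rewrite -subr_eq0 -rnorm_eq0 -sqrf_eq0; apply/eqP/(@complexI R).
have sW := subspace_orthogonal_compl (range (row_op T)).
rewrite -hdotxx {1}(_ : q - p = (x - p) - (x - q)); last first.
  by rewrite (opprB x q) [RHS]addrC addrA subrK.
have vW : wandering T (q - p) by exact: (subspace_setB sW qW pW).
by rewrite hdotBl xp// xq// subrr.
Qed.

End closed_range.

(** * Multi-indices *)

Section multi_index.
Context (n : nat).
Local Notation mindex := {ffun 'I_n -> nat}.
Implicit Types (a b : mindex) (i : 'I_n).

Definition minc i a : mindex := [ffun j => a j + (j == i)]%N.
(** Subtraction is truncated: this is [a - e_i] only if [0 < a i], a guard that accompanies its
    uses. *)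
Definition mdec i a : mindex := [ffun j => a j - (j == i)]%N.

Lemma mincK i : cancel (minc i) (mdec i).
Proof. by move=> a; apply/ffunP => j; rewrite !ffunE addnK. Qed.

Lemma mdecK i a : (0 < a i)%N -> minc i (mdec i a) = a.
Proof.
move=> ai; apply/ffunP => j; rewrite !ffunE subnK//.
by have [->|] := eqVneq j i.
Qed.

Lemma minc_gt0 i a : (0 < minc i a i)%N.
Proof. by rewrite ffunE eqxx addn1. Qed.

Lemma mdegree_minc i a : mdegree (minc i a) = (mdegree a).+1.
Proof.
rewrite /mdegree (eq_bigr (fun j => a j + (j == i))%N) => [|j _]; last by rewrite ffunE.
by rewrite big_split /= -big_mkcond big_pred1_eq addn1.
Qed.

Lemma mfactorial_minc i a : mfactorial (minc i a) = ((a i).+1 * mfactorial a)%N.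
Proof.
rewrite /mfactorial (bigD1 i)//= [in RHS](bigD1 i)//= !ffunE eqxx addn1 factS -!mulnA.
congr (_ * (_ * _))%N; apply: eq_bigr => j /negPf ji.
by rewrite ffunE ji addn0.
Qed.

Lemma mfactorial_gt0 a : (0 < mfactorial a)%N.
Proof. by apply: prodn_gt0 => i; exact: fact_gt0. Qed.

Lemma mdegree_eq0 a : (mdegree a == 0)%N = (a == [ffun=> 0%N]).
Proof.
rewrite /mdegree sum_nat_eq0; apply/forallP/eqP => [a0|-> i]; last by rewrite ffunE.
by apply/ffunP => i; rewrite ffunE; apply/eqP; exact: a0.
Qed.

Lemma mdegree0 : mdegree ([ffun=> 0%N] : mindex) = 0%N.
Proof. by apply/eqP; rewrite mdegree_eq0. Qed.

Lemma mdegree_gt0_exists a : (0 < mdegree a)%N -> exists i, (0 < a i)%N.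
Proof.
rewrite lt0n mdegree_eq0 => a0; apply/existsP; apply: contraR a0 => /existsPn a0.
by apply/eqP/ffunP => i; rewrite ffunE; apply/eqP; rewrite -leqn0 leqNgt.
Qed.

(** An explicit duplicate-free list, grown by unit vectors, so that sums over one degree are
    ordinary big sums open to induction on [k]. An index arises once from each coordinate of its
    support, hence [undup]. *)
Fixpoint degs (k : nat) : seq mindex :=
  if k is l.+1 then undup [seq minc i a | i <- enum 'I_n, a <- degs l]
  else [:: [ffun=> 0%N]].

Lemma degs_uniq k : uniq (degs k).
Proof. by case: k => //= k; exact: undup_uniq. Qed.

Lemma mem_degs k a : (a \in degs k) = (mdegree a == k).
Proof.
elim: k a => [|k IH] a /=; first by rewrite inE mdegree_eq0.
rewrite mem_undup; apply/allpairsP/eqP => [[[i b] /= [_ + ->]]|ak].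
  by rewrite IH mdegree_minc => /eqP ->.
have [|i ai] := @mdegree_gt0_exists a; first by rewrite ak.
exists (i, mdec i a); rewrite /= mem_enum mdecK//; split => //.
by rewrite IH -eqSS -(mdegree_minc i) (mdecK ai) ak.
Qed.

Arguments degs : simpl never.

Lemma degs_setE k : [set a : mindex | mdegree a = k] = [set` degs k].
Proof. by apply/seteqP; split => a /=; rewrite mem_degs => /eqP. Qed.

Lemma finite_degree k : finite_set [set a : mindex | mdegree a = k].
Proof. by rewrite degs_setE; exact: finite_seq. Qed.

Lemma fsbig_degs (V : nmodType) k (F : mindex -> V) :
  \sum_(a \in [set a | mdegree a = k]) F a = \sum_(a <- degs k) F a.
Proof. by rewrite degs_setE -fsbig_seq ?degs_uniq. Qed.

Lemma big_degs0 (V : nmodType) (F : mindex -> V) :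
  \sum_(a <- degs 0) F a = F [ffun=> 0%N].
Proof. by rewrite big_seq1. Qed.

Lemma sum_degs_minc (V : nmodType) k i (F : mindex -> V) :
  \sum_(a <- degs k) F a = \sum_(b <- degs k.+1 | (0 < b i)%N) F (mdec i b).
Proof.
rewrite -[RHS]big_filter.
have P : perm_eq [seq b : mindex <- degs k.+1 | (0 < b i)%N] (map (minc i) (degs k)).
  apply: uniq_perm => [||b]; first by rewrite filter_uniq ?degs_uniq.
    by rewrite map_inj_uniq ?degs_uniq//; exact: can_inj (mincK i).
  rewrite mem_filter mem_degs; apply/andP/mapP => [[bi /eqP bk]|[a + ->]].
    exists (mdec i b); last by rewrite mdecK.
    by rewrite mem_degs -eqSS -(mdegree_minc i) mdecK// bk.
  by rewrite minc_gt0 mdegree_minc mem_degs => /eqP ->.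
by rewrite (perm_big _ P) big_map; apply: eq_bigr => a _; rewrite mincK.
Qed.

Section multinomial.
Context (F : numFieldType).

Definition multinom a : F := ((mdegree a)`!)%:R / (mfactorial a)%:R.

Lemma multinom_gt0 a : 0 < multinom a.
Proof. by rewrite divr_gt0 ?ltr0n ?fact_gt0 ?mfactorial_gt0. Qed.

Lemma multinom0 : multinom [ffun=> 0%N] = 1.
Proof.
rewrite /multinom mdegree0 /mfactorial big1 ?divr1// => i _.
by rewrite ffunE.
Qed.

Lemma multinom_mdec i b : (0 < b i)%N ->
  multinom (mdec i b) = (b i)%:R / (mdegree b)%:R * multinom b.
Proof.
move=> bi; rewrite /multinom -[in RHS](mdecK bi); set a := mdec i b.
rewrite mfactorial_minc mdegree_minc factS !natrM.
have -> : (minc i a i) = (a i).+1 by rewrite ffunE eqxx addn1.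
have K (x y p q : F) : x != 0 -> y != 0 -> q != 0 -> p / q = x / y * (y * p / (x * q)).
  by move=> x0 y0 q0; field; rewrite x0 y0 q0.
by apply: K; rewrite pnatr_eq0// -lt0n mfactorial_gt0.
Qed.

(** The multinomial Pascal rule: [multinom (b - e_i)] is the fraction [b_i / |b|] of [multinom b],
    and these fractions add up to 1. *)
Lemma sum_multinom_minc (V : lmodType F) k (g : mindex -> V) :
  \sum_(b <- degs k.+1) multinom b *: g b =
  \sum_(i < n) \sum_(a <- degs k) multinom a *: g (minc i a).
Proof.
transitivity (\sum_(i < n) \sum_(b <- degs k.+1 | (0 < b i)%N) multinom (mdec i b) *: g b);
  last first.
  apply: eq_bigr => i _; rewrite (sum_degs_minc k i).
  by apply: eq_bigr => b bi; rewrite mdecK.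
under [RHS]eq_bigr do rewrite big_mkcond.
rewrite exchange_big /= big_seq [RHS]big_seq; apply: eq_bigr => b.
rewrite mem_degs => /eqP bk; rewrite -big_mkcond /=.
rewrite (eq_bigr (fun i => ((b i)%:R / k.+1%:R * multinom b) *: g b)) => [|i bi]; last first.
  by rewrite multinom_mdec// bk.
rewrite -scaler_suml -!mulr_suml; congr (_ *: _).
suff -> : \sum_(i < n | (0 < b i)%N) (b i)%:R = k.+1%:R :> F.
  by rewrite divff ?mul1r// pnatr_eq0.
rewrite -bk /mdegree natr_sum big_mkcond; apply: eq_bigr => i _.
by case: (b i).
Qed.

End multinomial.

Lemma monom_minc (R : realType) (z : 'rV[R[i]]_n) i a :
  monom z (minc i a) = z ord0 i * monom z a.
Proof.
rewrite /monom (bigD1 i)//= [in RHS](bigD1 i)//= !ffunE eqxx addn1 exprS -!mulrA.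
congr (_ * (_ * _)); apply: eq_bigr => j /negPf ji.
by rewrite ffunE ji addn0.
Qed.

Lemma monom0 (R : realType) (z : 'rV[R[i]]_n) : monom z [ffun=> 0%N] = 1.
Proof. by rewrite /monom big1// => i _; rewrite ffunE. Qed.

Lemma monomZ (R : realType) (t : R[i]) (z : 'rV[R[i]]_n) a :
  monom (t *: z) a = t ^+ mdegree a * monom z a.
Proof.
rewrite /monom /mdegree -prodrXr -big_split; apply: eq_bigr => i _.
by rewrite mxE exprMn.
Qed.

Section words.
Context (R : realType) (H : hilbertType R) (S : 'I_n -> H -> H).

(** Compositions in a prescribed order. They make sense without commutativity, which is how powers
    of [L_op T] are treated, and they allow induction letter by letter. *)
Definition wordop (w : seq 'I_n) (x : H) : H := foldr (fun i y => S i y) x w.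

Definition wordof a : seq 'I_n := flatten [seq nseq (a i) i | i <- index_enum 'I_n].

Lemma tuple_pow_wordop a : tuple_pow S a = wordop (wordof a).
Proof.
rewrite /tuple_pow /wordof; elim: (index_enum _) => [|i r IH]; first by rewrite big_nil.
rewrite big_cons IH /=; apply/funext => x; rewrite /wordop foldr_cat /=.
by elim: (a i) => //= k ->.
Qed.

Lemma size_wordof a : size (wordof a) = mdegree a.
Proof.
rewrite /wordof /mdegree size_flatten /shape -map_comp sumnE big_map.
by apply: eq_bigr => i _; rewrite /= size_nseq.
Qed.

Lemma wordop_rcons w i x : wordop (rcons w i) x = wordop w (S i x).
Proof. by rewrite /wordop foldr_rcons. Qed.

Hypothesis Scomm : forall i j x, S i (S j x) = S j (S i x).

Lemma tuple_pow0 : tuple_pow S [ffun=> 0%N] = idfun.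
Proof.
rewrite /tuple_pow; elim: (index_enum _) => [|i r IH]; first by rewrite big_nil.
by rewrite big_cons IH ffunE.
Qed.

Let iterC i j k x : S i (iter k (S j) x) = iter k (S j) (S i x).
Proof. by elim: k => //= k IH; rewrite Scomm IH. Qed.

Lemma tuple_pow_minc i a x : tuple_pow S (minc i a) x = S i (tuple_pow S a x).
Proof.
rewrite /tuple_pow.
have := index_enum_uniq 'I_n; have := mem_index_enum i.
elim: (index_enum _) => //= j r IH; rewrite inE !big_cons.
have [<- _ /andP[ir _]|ij /= ir /andP[_ ur]] := eqVneq i j.
  rewrite /= ffunE eqxx addn1 /=; congr (S i (iter _ _ _)).
  have {}IH : \big[comp/idfun]_(j <- r) iter (minc i a j) (S j) =
              \big[comp/idfun]_(j <- r) iter (a j) (S j).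
    rewrite big_seq [RHS]big_seq; apply: eq_bigr => l lr.
    rewrite ffunE (_ : l == i = false) ?addn0//.
    by apply: contraNF ir => /eqP <-.
  by rewrite IH.
by rewrite /= IH// ffunE eq_sym (negPf ij) addn0 iterC.
Qed.

Lemma tuple_powC i a x : S i (tuple_pow S a x) = tuple_pow S a (S i x).
Proof.
rewrite tuple_pow_wordop; elim: (wordof a) => //= j w IH.
by rewrite /= Scomm; congr (S j _).
Qed.

Lemma tuple_pow_bounded a : (forall i, bounded_op (S i)) -> bounded_op (tuple_pow S a).
Proof.
move=> bS; rewrite tuple_pow_wordop; elim: (wordof a) => [|i w IH].
  exact: bounded_op_idfun.
exact: (bounded_op_comp (bS i) IH).
Qed.

Definition wtype (w : seq 'I_n) : mindex := foldr minc [ffun=> 0%N] w.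

Lemma wordop_wtype w : wordop w = tuple_pow S (wtype w).
Proof.
elim: w => [|i w IH] /=; first by rewrite tuple_pow0.
by apply/funext => x /=; rewrite tuple_pow_minc IH.
Qed.

Lemma wtype_surj a : exists w, wtype w = a.
Proof.
move: {2}(mdegree a) (erefl (mdegree a)) => k; elim: k a => [|k IH] a ak.
  by exists [::] => /=; apply/esym/eqP; rewrite -mdegree_eq0 ak.
have [|i ai] := @mdegree_gt0_exists a; first by rewrite ak.
have [|w wE] := IH (mdec i a).
  by apply: succn_inj; rewrite -(mdegree_minc i) mdecK.
by exists (i :: w); rewrite /= wE mdecK.
Qed.

Lemma multinomial_iter (z : 'rV[R[i]]_n) k x : (forall i, bounded_op (S i)) ->
  iter k (fun y => \sum_(i < n) z ord0 i *: S i y) x =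
  \sum_(a <- degs k) multinom R[i] a *: (monom z a *: tuple_pow S a x).
Proof.
move=> bS; elim: k => [|k IH].
  by rewrite big_degs0 monom0 tuple_pow0 multinom0 !scale1r.
rewrite iterS IH sum_multinom_minc; apply: eq_bigr => i _.
rewrite bounded_op_sum// scaler_sumr; apply: eq_bigr => a _.
rewrite 2!(bounded_opZ _ _ (bS i)) monom_minc tuple_pow_minc !scalerA; congr (_ *: _).
by rewrite [z ord0 i * _]mulrC -mulrA.
Qed.

End words.
End multi_index.

(** * The coefficients of (1 - t)^(-m) and iterated differences *)

(** The truncated predecessor makes [hcoef 0] the sequence 1, 0, 0, ..., the coefficients of
    [(1 - t)^0], so that inductions on [m] can start at 0. *)
Definition hcoef (m k : nat) : nat := 'C((m + k).-1, k).

Lemma hcoefn0 m : hcoef m 0 = 1%N. Proof. by rewrite /hcoef bin0. Qed.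

Lemma hcoef0S k : hcoef 0 k.+1 = 0%N.
Proof. by rewrite /hcoef bin_small. Qed.

Lemma hcoef_pascal m k : hcoef m.+1 k.+1 = (hcoef m.+1 k + hcoef m k.+1)%N.
Proof. by rewrite /hcoef !addSn addnS /= binS addnC. Qed.

Lemma hcoef_gt0 m k : (0 < m)%N -> (0 < hcoef m k)%N.
Proof. by case: m => // m _; rewrite /hcoef addSn /= bin_gt0 leq_addl. Qed.

Lemma leq_hcoef m k j : (0 < m)%N -> (hcoef m k <= hcoef m (k + j))%N.
Proof.
case: m => // m _; elim: j => [|j IH]; first by rewrite addn0.
by rewrite addnS hcoef_pascal (leq_trans IH)// leq_addr.
Qed.

Lemma rhoE (R : realType) n m (a : {ffun 'I_n -> nat}) : (0 < m)%N ->
  rho R m a = (hcoef m (mdegree a))%:R * multinom R a.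
Proof.
case: m => // m _; rewrite /rho /multinom /hcoef addSn /=.
set k := mdegree a.
have -> : ((m + k)`!)%:R = ('C(m + k, k))%:R * (k`! * m`!)%:R :> R.
  by have := bin_fact (leq_addl m k); rewrite addnK => <-; rewrite natrM.
rewrite !natrM; have K (x y p q : R) : y != 0 -> q != 0 -> p * (x * y) / (q * y) = p * (x / q).
  by move=> y0 q0; field; rewrite y0 q0.
by rewrite K// pnatr_eq0 -lt0n ?fact_gt0 ?mfactorial_gt0.
Qed.

Section differences.
Context (F : comNzRingType).

(** Multiplication of the generating function by [1 - t]. *)
Definition backward (f : nat -> F) (k : nat) : F :=
  f k - (if k is l.+1 then f l else 0).

Lemma iter_backward m (f : nat -> F) k : iter m backward f k =
  \sum_(j < k.+1) (-1) ^+ j * ('C(m, j))%:R * f (k - j)%N.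
Proof.
elim: m k => [|m IH] k.
  rewrite big_ord_recl /= bin0 mulr1 mul1r subn0 big1 ?addr0// => i _.
  by rewrite bin0n /= mulr0 mul0r.
rewrite iterS /backward IH; case: k => [|k].
  by rewrite !big_ord_recl !big_ord0 !bin0 subr0.
rewrite IH big_ord_recl [RHS]big_ord_recl !bin0 -addrA; congr (_ + _).
rewrite -sumrB; apply: eq_bigr => j _; rewrite lift0 subSS binS natrD exprS.
by ring.
Qed.

Lemma iter_backward_hcoef m :
  iter m backward (fun k => (hcoef m k)%:R) = fun k => (hcoef 0 k)%:R.
Proof.
elim: m => // m IH; rewrite iterSr -IH; congr (iter m _ _).
apply/funext => -[|k]; rewrite /backward; first by rewrite !hcoefn0 subr0.
by rewrite hcoef_pascal natrD addrC addKr.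
Qed.

(** The coefficient of [t^(k+1)] in [(1 - t)^m (1 - t)^(-m) = 1], solved for the leading term. The
    weights are those of [Delta_op], and the zero branch is the one that occurs in [A_sig]. *)
Lemma hcoef_rec m k : (hcoef m k.+1)%:R =
  \sum_(j < m) (-1) ^+ j * ('C(m, j.+1))%:R *
     (if (j <= k)%N then (hcoef m (k - j))%:R else 0) :> F.
Proof.
have := congr1 (fun f => f k.+1) (iter_backward_hcoef m).
rewrite iter_backward hcoef0S big_ord_recl bin0 subn0 !mul1r => /eqP.
rewrite addr_eq0 => /eqP ->; rewrite -sumrN.
pose G j : F := (-1) ^+ j * ('C(m, j.+1))%:R *
     (if (j <= k)%N then (hcoef m (k - j))%:R else 0).
transitivity (\sum_(j < k.+1) G j).
  apply: eq_bigr => j _; rewrite lift0 subSS /G -ltnS ltn_ord exprS; ring.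
(* Both sums are padded to a common range: the conditional kills [j > k], the binomial coefficient
   kills [j >= m]. *)
rewrite (big_ord_widen (k.+1 + m) G) ?leq_addr//.
rewrite [RHS](big_ord_widen (k.+1 + m) G) ?leq_addl//.
rewrite big_mkcond [RHS]big_mkcond; apply: eq_bigr => j _ /=.
rewrite /G -[(j < k.+1)%N]/(j <= k)%N.
case: (leqP j k) => _; case: (ltnP j m) => jm; rewrite ?mulr0//.
by rewrite bin_small ?mulr0 ?mul0r // ltnS.
Qed.

End differences.

Section forward.
Context (F : comNzRingType) (V : lmodType F).

Definition forward (u : nat -> V) (k : nat) : V := u k - u k.+1.

Lemma iter_forward m (u : nat -> V) k : iter m forward u k =
  \sum_(j < m.+1) ((-1) ^+ j * ('C(m, j))%:R) *: u (k + j)%N.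
Proof.
elim: m k => [|m IH] k.
  by rewrite big_ord_recl big_ord0 bin0 mulr1 scale1r addn0 addr0.
rewrite iterS /forward !IH [RHS]big_ord_recl [X in X - _]big_ord_recl /= -addrA.
rewrite !bin0; congr (_ + _).
transitivity (\sum_(j < m.+1)
    (((-1) ^+ j.+1 * ('C(m, j.+1))%:R) *: u (k + j.+1)%N
     + ((-1) ^+ j.+1 * ('C(m, j))%:R) *: u (k + j.+1)%N)).
  rewrite big_split /= [in RHS]big_ord_recr /= bin_small// mulr0 scale0r addr0.
  congr (_ + _); rewrite -sumrN; apply: eq_bigr => j _.
  by rewrite exprS mulN1r mulNr scaleNr addnS addSn.
by apply: eq_bigr => j _; rewrite -scalerDl -mulrDr -natrD binS.
Qed.

End forward.

(** Such a sequence is polynomial of degree below [m] and tends to 0 only if it is 0. In the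
    induction, [forward u] vanishes, so [u] is constant and equal to its limit. *)
Lemma iter_forward_eq0 (R : realType) (V : normedModType R[i]) m (u : nat -> V) :
  u @ \oo --> (0 : V) -> (forall k, iter m (@forward _ V) u k = 0) -> forall k, u k = 0.
Proof.
elim: m u => // m IH u u0 um k.
have cst j : u j.+1 = u j.
  suff : forward u j = 0 by move/eqP; rewrite subr_eq0 => /eqP ->.
  apply: (IH (forward u)) => [|l]; last by rewrite -iterSr.
  rewrite -[0 in X in _ --> X](subr0 (0 : V)); apply: cvgB => //.
  by move: u0; rewrite -cvg_shiftS.
have cst' j : u j = u k.
  have E l : u l = u 0%N by elim: l => // l; rewrite cst.
  by rewrite E [RHS]E.
have : u @ \oo --> u k.
  apply/cvg_rnormP => e e0; exists 0%N => j _; by rewrite cst' subrr rnorm0.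
by move/rnorm_limit_unique; exact.
Qed.

(** * Uniqueness of power series coefficients *)

Section power_series.
Context (R : realType) (V : normedModType R[i]).
Local Notation C := R[i].

Lemma seriesS (u : nat -> V) N : series u N.+1 = series u N + u N.
Proof. by rewrite /series /= big_nat_recr. Qed.

Lemma series_cvg_bounded (u : nat -> V) (l : V) : series u @ \oo --> l ->
  exists2 M : R, 0 <= M & forall k, rnorm (u k) <= M.
Proof.
move=> /cvg_rnormP/(_ _ ltr01)[N NP].
exists (2 + \sum_(j < N) rnorm (u j)) => [|k].
  by rewrite addr_ge0// sumr_ge0// => j _; exact: rnorm_ge0.
have [kN|Nk] := ltnP k N.
  rewrite (bigD1 (Ordinal kN))//= addrCA lerDl addr_ge0//.
  by apply: sumr_ge0 => j _; exact: rnorm_ge0.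
have -> : u k = (series u k.+1 - l) - (series u k - l).
  by rewrite seriesS opprB addrA subrK addrC addKr.
apply: (le_trans (ler_rnormB _ _)).
have := NP _ (leqW Nk); have := NP _ Nk.
have : 0 <= \sum_(j < N) rnorm (u j) by apply: sumr_ge0 => j _; exact: rnorm_ge0.
move: (\sum_(j < N) _) (rnorm _) (rnorm _) => a b c; lra.
Qed.

(** Convergence at [s = d / 2] bounds [s^k |v k|] by some [M]. At [t = q s] with [q <= 1/2] the
    terms of positive degree then add up to at most [2 M q], which tends to 0 with [q]. *)
Lemma power_series_coef0 (v : nat -> V) (d : R) : 0 < d ->
  (forall t : R, 0 < t < d -> series (fun k => (t ^+ k)%:C *: v k) @ \oo --> (0 : V)) ->
  v 0%N = 0.
Proof.
move=> d0 vt; apply/eqP; rewrite -rnorm_eq0 eq_le rnorm_ge0 andbT.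
have s0 : 0 < d / 2 by rewrite divr_gt0.
set s := d / 2 in s0.
have [M M0 MP] : exists2 M : R, 0 <= M & forall k, s ^+ k * rnorm (v k) <= M.
  have [|M M0 MP] := series_cvg_bounded (vt s _); first by rewrite s0 /s; lra.
  exists M => // k; have := MP k.
  by rewrite rnormZ cabs_real ?exprn_ge0// ltW.
have est (q : R) : 0 < q <= 2^-1 -> rnorm (v 0%N) <= 2 * M * q.
  move=> /andP[q0 q2]; apply/ler_addgt0Pr => e e0.
  have qd : 0 < q * s < d.
    rewrite mulr_gt0//= /s; move: q2 d0 q0; clear; nra.
  have /cvg_rnormP/(_ e e0)[N NP] := vt _ qd.
  have := NP _ (leqnSn N); rewrite subr0 /series /= big_nat_recl//= expr0 scale1r.
  set S := \sum_(_ <= _ < _) _ => le1.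
  have -> : v 0%N = (v 0%N + S) - S by rewrite addrK.
  apply: (le_trans (ler_rnormB _ _)).
  suff : rnorm S <= 2 * M * q by move: (rnorm _) (rnorm S) le1 => a b; lra.
  have : rnorm S <= \sum_(0 <= k < N) (q ^+ k.+1 * M).
    apply: (le_trans (ler_rnorm_sum _ _ _)); apply: ler_sum => k _.
    have qs0 : 0 <= q * s by rewrite mulr_ge0 ?ltW.
    rewrite rnormZ cabs_real ?exprn_ge0// exprMn -mulrA.
    by apply: ler_wpM2l; [rewrite exprn_ge0// ltW|exact: MP].
  move=> /le_trans; apply.
  suff : \sum_(0 <= k < N) q ^+ k.+1 <= 2 * q - 2 * q ^+ N.+1.
    have qN : 0 <= q ^+ N.+1 by rewrite exprn_ge0// ltW.
    rewrite -mulr_suml; move: (\sum_(_ <= _ < _) _) (q ^+ N.+1) qN => a b b0 ab.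
    have : a * M <= 2 * q * M by rewrite ler_wpM2r//; lra.
    by rewrite mulrAC.
  elim: {S le1 NP} N => [|N IH]; first by rewrite big_geq// expr1 subrr.
  rewrite big_nat_recr//=; apply: (le_trans (lerD IH (lexx _))).
  have qN : 0 <= q ^+ N.+1 by rewrite exprn_ge0// ltW.
  by rewrite (exprS q N.+1); move: (q ^+ N.+1) qN => a a0; nra.
apply/ler_addgt0Pr => e e0; rewrite add0r.
pose q := Num.min 2^-1 (e / (2 * M + 1)).
have M1 : 0 < 2 * M + 1 by lra.
have q0 : 0 < q by rewrite lt_min invr_gt0 divr_gt0 ?ltr0n.
have q2 : q <= 2^-1 by rewrite ge_min lexx.
have qe : q * (2 * M + 1) <= e by rewrite -ler_pdivlMr// ge_min lexx orbT.
have := est q; rewrite q0 q2 => /(_ isT); nra.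
Qed.

Lemma power_series_unique (v : nat -> V) (d : R) : 0 < d ->
  (forall t : R, 0 < t < d -> series (fun k => (t ^+ k)%:C *: v k) @ \oo --> (0 : V)) ->
  forall k, v k = 0.
Proof.
move=> d0 vt k; elim: k v vt => [|k IH] v vt; first exact: power_series_coef0 vt.
have v0 := power_series_coef0 d0 vt.
apply: (IH (fun k => v k.+1)) => t td; have /andP[t0 _] := td.
have -> : series (fun k => (t ^+ k)%:C *: v k.+1) =
    fun N => t^-1%:C *: series (fun k => (t ^+ k)%:C *: v k) N.+1.
  apply/funext => N; rewrite /series /= big_nat_recl//= v0 scaler0 add0r scaler_sumr.
  apply: eq_bigr => j _; rewrite scalerA -rmorphM /= exprS mulKf ?gt_eqF//.
have := vt t td; rewrite -cvg_shiftS => h.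
rewrite -[X in _ --> X](scaler0 V t^-1%:C). exact: cvgZl_tmp h.
Qed.

End power_series.

(** Separates the monomials in the Kronecker substitution of [polynomial_coef_eq0], where the
    exponents are digits in base [B]. *)
Lemma base_expansion_inj (B n : nat) (f g : nat -> nat) :
  (forall i, (i < n)%N -> (f i < B)%N /\ (g i < B)%N) ->
  (\sum_(i < n) f i * B ^ i = \sum_(i < n) g i * B ^ i)%N ->
  forall i, (i < n)%N -> f i = g i.
Proof.
elim: n f g => // n IH f g fgB.
have E (h : nat -> nat) : (\sum_(i < n.+1) h i * B ^ i = h 0 + (\sum_(i < n) h i.+1 * B ^ i) * B)%N.
  rewrite big_ord_recl expn0 muln1; congr (_ + _)%N.
  by rewrite big_distrl; apply: eq_bigr => i _; rewrite /= expnSr mulnA.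
have [f0 g0] := fgB 0%N isT.
rewrite !E => fg.
have fg0 : f 0%N = g 0%N.
  have := congr1 (fun x => x %% B)%N fg.
  by rewrite ![(_ + _ * B)%N]addnC !modnMDl !modn_small.
move: fg; rewrite fg0 => /addnI/eqP.
rewrite eqn_pmul2r; last exact: leq_ltn_trans g0.
move=> /eqP fg [|i]//; rewrite ltnS => iltn.
by apply: (IH (fun i => f i.+1) (fun i => g i.+1)) => // j jn; exact: fgB.
Qed.

Section expansions.
Context (R : realType) (n : nat) (V : normedModType R[i]).
Local Notation C := R[i].
Local Notation mindex := {ffun 'I_n -> nat}.

Lemma enormZ (t : R) (z : 'rV[C]_n) : 0 <= t -> enorm (t%:C *: z) = t * enorm z.
Proof.
move=> t0; rewrite /enorm.
rewrite (eq_bigr (fun i => t ^+ 2 * rnorm (z ord0 i : C^o) ^+ 2)) => [|i _].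
  by rewrite -mulr_sumr sqrtrM ?sqr_ge0// sqrtr_sqr ger0_norm.
by rewrite mxE -exprMn; congr (_ ^+ 2); rewrite (rnormZ t%:C (z ord0 i : C^o)) cabs_real.
Qed.

Lemma mindex_le_degree (a : mindex) i : (a i <= mdegree a)%N.
Proof. by rewrite /mdegree (bigD1 i)//= leq_addr. Qed.

(** Kronecker substitution [z_i = t^((k+1)^i)]: the exponents of a multi-index of degree [k] are
    digits in base [k + 1], so distinct monomials become distinct powers of the single variable
    [t]. *)
Lemma polynomial_coef_eq0 k (v : mindex -> V) :
  (forall z : 'rV[C]_n, enorm z < 1 -> \sum_(a <- degs n k) monom z a *: v a = 0) ->
  forall a, mdegree a = k -> v a = 0.
Proof.
move=> v0 a ak.
pose e (b : mindex) := (\sum_(i < n) b i * k.+1 ^ i)%N.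
have e_inj b : mdegree b = k -> e b = e a -> b = a.
  move=> bk eba; apply/ffunP => i.
  pose f (c : mindex) j := if insub j is Some l then c l else 0%N.
  have fE (c : mindex) (j : 'I_n) : f c j = c j by rewrite /f valK.
  rewrite -!fE; apply: (@base_expansion_inj k.+1 n) (ltn_ord i).
    move=> j jn; rewrite -[j]/(val (Ordinal jn)) !fE !ltnS -{1}bk -ak.
    by rewrite !mindex_le_degree.
  under eq_bigr do rewrite fE.
  by under [RHS]eq_bigr do rewrite fE.
pose w (j : nat) := \sum_(b <- degs n k | e b == j) v b.
have wea : w (e a) = v a.
  rewrite /w -big_filter (_ : [seq b <- degs n k | e b == e a] = [:: a]) ?big_seq1//.
  have -> : [seq b <- degs n k | e b == e a] = [seq b <- degs n k | b == a].
    apply: eq_in_filter => b; rewrite mem_degs => /eqP bk.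
    by apply/eqP/eqP => [|->//]; exact: e_inj.
  by rewrite filter_pred1_uniq ?degs_uniq// mem_degs ak.
rewrite -wea.
(* Exceeds every exponent that occurs, so the partial sums are final from [E] on. *)
pose E := (\sum_(b <- degs n k) e b).+1.
(* For [t < 1 / (n + 1)] every coordinate has squared modulus at most [t], so [|z|^2 <= n t < 1] and
   [z] stays in the ball. *)
have d0 : 0 < n.+1%:R^-1 :> R by rewrite invr_gt0.
apply: (power_series_unique d0) => t /andP[t0 tn].
pose z : 'rV[C]_n := \row_i (t ^+ (k.+1 ^ i))%:C.
have t1 : t <= 1 by apply: (le_trans (ltW tn)); rewrite invf_le1// ler1n.
have zn : enorm z < 1.
  rewrite /enorm -sqrtr1 ltr_sqrt//.
  apply: (@le_lt_trans _ _ (\sum_(i < n) t)).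
    apply: ler_sum => i _; rewrite mxE -[rnorm _]/(cabs _) cabs_real; last by rewrite exprn_ge0// ltW.
    rewrite -exprM -[X in _ <= X](expr1 t).
    by apply: ler_wiXn2l; rewrite ?(ltW t0)// muln_gt0 expn_gt0.
  rewrite sumr_const card_ord -mulr_natl.
  move: tn; rewrite -[n.+1%:R^-1]mul1r ltr_pdivlMr//; apply: le_lt_trans.
  by rewrite mulrC ler_wpM2l ?ler_nat// ltW.
have mz b : monom z b = (t ^+ e b)%:C.
  rewrite /monom /e -prodrXr rmorph_prod; apply: eq_bigr => i _.
  by rewrite mxE -rmorphXn -exprM mulnC.
apply/cvg_rnormP => eps eps0; exists E => N EN.
suff -> : series (fun j => (t ^+ j)%:C *: w j) N = 0 by rewrite subrr rnorm0.
rewrite -(v0 z zn) /series /=.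
transitivity (\sum_(j < N) \sum_(b <- degs n k) if e b == j then (t ^+ j)%:C *: v b else 0).
  by rewrite big_mkord; apply: eq_bigr => j _; rewrite /w scaler_sumr big_mkcond.
rewrite exchange_big /= big_seq [RHS]big_seq; apply: eq_bigr => b bk.
have ebN : (e b < N)%N.
  apply: leq_trans EN; rewrite ltnS /E (bigD1_seq b) ?degs_uniq//=; exact: leq_addr.
rewrite -big_mkcond (big_pred1 (Ordinal ebN)) => [|j]; first by rewrite /= mz.
by rewrite eq_sym.
Qed.

Lemma uball_scale (z : 'rV[C]_n) (t : R) : enorm z < 1 -> 0 < t < 1 ->
  enorm (t%:C *: z) < 1.
Proof.
move=> z1 /andP[t0 t1]; rewrite enormZ ?ltW//.
have : 0 <= enorm z by exact: sqrtr_ge0.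
move: (enorm z) z1 => a; nra.
Qed.

End expansions.

Section expansion_unique.
Context (R : realType) (n : nat) (V : hilbertType R).
Local Notation C := R[i].
Local Notation mindex := {ffun 'I_n -> nat}.

Lemma has_expansion_degs (c : mindex -> V) (f : uball R n -> V) : has_expansion c f <->
  forall z : uball R n,
    series (fun k => \sum_(a <- degs n k) monom (val z) a *: c a) @ \oo --> f z.
Proof.
have E (z : uball R n) : (fun k => \sum_(a \in [set a : mindex | mdegree a = k])
    monom (val z) a *: c a) = fun k => \sum_(a <- degs n k) monom (val z) a *: c a.
  by apply/funext => k; rewrite fsbig_degs.
by split=> fc z; have := fc z; rewrite E.
Qed.

(** Along each ray [t z] the expansion is a power series in [t], which isolates the homogeneous
    parts; these determine their coefficients. Hence the choice inside [Hm_sqnorm] is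
    unambiguous. *)
Lemma has_expansion_unique (c c' : mindex -> V) (f : uball R n -> V) :
  has_expansion c f -> has_expansion c' f -> c = c'.
Proof.
move=> /has_expansion_degs cf /has_expansion_degs cf'; apply/funext => a.
apply/eqP; rewrite -subr_eq0; apply/eqP.
apply: (@polynomial_coef_eq0 R n V (mdegree a) (fun a => c a - c' a)) => // z z1.
apply: (power_series_unique (v := fun k => \sum_(b <- degs n k) monom z b *: (c b - c' b))
  ltr01) => t t1.
pose tz : uball R n := exist _ (t%:C *: z) (uball_scale z1 t1).
have cvg0 := cvgB (cf tz) (cf' tz); rewrite subrr in cvg0.
set S := (X in X @ _ --> _).
rewrite (_ : S = fun N =>
  series (fun k => \sum_(b <- degs n k) monom (val tz) b *: c b) N -
  series (fun k => \sum_(b <- degs n k) monom (val tz) b *: c' b) N); first exact: cvg0.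
apply/funext => N; rewrite /S /series /= -sumrB; apply: eq_bigr => k _.
rewrite -sumrB scaler_sumr big_seq [RHS]big_seq; apply: eq_bigr => b.
rewrite mem_degs => /eqP bk; rewrite -scalerBr monomZ bk scalerA rmorphXn.
by [].
Qed.

Lemma Hm_sqnorm_expansion m (c : mindex -> V) (f : uball R n -> V) :
  has_expansion c f -> Hm_sqnorm m f = coef_sqnorm m c.
Proof.
move=> cf; rewrite /Hm_sqnorm; case: xgetP => [c' _ /= c'f|/(_ c)//].
by rewrite (has_expansion_unique c'f cf).
Qed.

End expansion_unique.

(** * The norm of the weighted Bergman spaces *)

Lemma nonneg_partial_sums_cvg (R : realType) (b : nat -> R) (B : R) :
  (forall k, 0 <= b k) -> (forall N, \sum_(k < N) b k <= B) ->
  exists2 L : R, (fun N => \sum_(k < N) b k) @ \oo --> L & forall N, \sum_(k < N) b k <= L.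
Proof.
move=> b0 bB; pose S N := \sum_(k < N) b k.
have ndS : nondecreasing_seq S.
  by apply/nondecreasing_seqP => N; rewrite /S big_ord_recr /= lerDl.
have cS : cvgn S.
  by apply: nondecreasing_is_cvgn => //; exists B => _ [N _ <-]; exact: bB.
exists (limn S) => // N; exact: nondecreasing_cvgn_le.
Qed.

Lemma series_normal_cvg (R : realType) (V : completeNormedModType R[i])
    (u : nat -> V) (b : nat -> R) (B : R) :
  (forall k, rnorm (u k) <= b k) -> (forall N, \sum_(k < N) b k <= B) ->
  exists l : V, series u @ \oo --> l.
Proof.
move=> ub bB; have b0 k : 0 <= b k by apply: le_trans (ub k); exact: rnorm_ge0.
have [L bL leL] := nonneg_partial_sums_cvg b0 bB.
apply: cauchy_rnorm => e e0.
have [N _ NP] : \forall N \near \oo, L - e / 2 < \sum_(k < N) b k.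
  by apply: cvgr_gt bL _ _; rewrite ltrBlDr ltrDl divr_gt0.
have le_tail i j : (N <= i <= j)%N -> rnorm (series u j - series u i) < e / 2.
  move=> /andP[Ni ij]; have -> : series u j - series u i = \sum_(i <= k < j) u k.
    by rewrite /series /= (big_cat_nat (leq0n i) ij)//= addrAC subrr add0r.
  apply: (le_lt_trans (ler_rnorm_sum _ _ _)).
  apply: (@le_lt_trans _ _ (\sum_(i <= k < j) b k)); first exact: ler_sum.
  have := leL j; have := NP _ Ni; rewrite -!(big_mkord xpredT).
  rewrite (big_cat_nat (leq0n i) ij)//=.
  by move: (\sum_(0 <= k < i) _) (\sum_(i <= k < j) _) => x y; lra.
have lt2 i : (N <= i)%N -> rnorm (series u i - series u N) < e / 2.
  by move=> Ni; apply: le_tail; rewrite leqnn.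
exists N => i j Ni Nj.
apply: (le_lt_trans (rnorm_dist_triangle _ (series u N) _)).
have := lt2 _ Ni; have := lt2 _ Nj; rewrite [rnorm (series u j - _)]rnorm_distC.
by move: (rnorm _) (rnorm _) => x y; lra.
Qed.

(** Multiplied by [1 - r], the partial sums for [m + 1] are dominated by those for [m]: Pascal's
    rule is the identity [(1 - r) (1 - r)^(-m-1) = (1 - r)^(-m)]. *)
Lemma hcoef_series_bounded (R : realType) m (r : R) : 0 <= r < 1 ->
  exists B, forall N, \sum_(k < N) (hcoef m k)%:R * r ^+ k <= B.
Proof.
move=> /andP[r0 r1]; elim: m => [|m [B BP]].
  exists 1 => -[|N]; first by rewrite big_ord0.
  rewrite big_ord_recl hcoefn0 expr0 mulr1 big1 ?addr0// => k _.
  by rewrite lift0 hcoef0S mul0r.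
have r1' : 0 < 1 - r by rewrite subr_gt0.
exists (B / (1 - r)) => N; rewrite ler_pdivlMr//.
case: N => [|N].
  by rewrite big_ord0 mul0r; have := BP 0%N; rewrite big_ord0.
pose A N := \sum_(k < N) (hcoef m.+1 k)%:R * r ^+ k.
have AS : A N.+1 = \sum_(k < N.+1) (hcoef m k)%:R * r ^+ k + r * A N.
  rewrite /A big_ord_recl [in RHS]big_ord_recl !hcoefn0 -addrA; congr (_ + _).
  rewrite mulr_sumr -big_split; apply: eq_bigr => k _.
  by rewrite lift0 hcoef_pascal natrD exprS /=; ring.
have AN : A N <= A N.+1.
  by rewrite /A big_ord_recr /= lerDl mulr_ge0 ?exprn_ge0.
rewrite -/(A N.+1); apply: le_trans (BP N.+1).
rewrite [A N.+1 * _]mulrBr mulr1 {1}AS -addrA gerDl subr_le0 [A N.+1 * _]mulrC.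
by rewrite ler_wpM2l.
Qed.

Section coefficient_norm.
Context (R : realType) (n m : nat) (V : hilbertType R) (m0 : (0 < m)%N).
Local Notation C := R[i].
Local Notation mindex := {ffun 'I_n -> nat}.
Implicit Types c : mindex -> V.

Lemma rho_gt0 (a : mindex) : 0 < rho R m a.
Proof. by rewrite rhoE// mulr_gt0 ?multinom_gt0// ltr0n hcoef_gt0. Qed.

Definition degree_sqnorm c k : R := \sum_(a <- degs n k) rnorm (c a) ^+ 2 / rho R m a.

Lemma degree_sqnorm_ge0 c k : 0 <= degree_sqnorm c k.
Proof. by apply: sumr_ge0 => a _; rewrite divr_ge0 ?sqr_ge0// ltW// rho_gt0. Qed.

Lemma coef_sqnormE c : coef_sqnorm m c = (\sum_(0 <= k <oo) (degree_sqnorm c k)%:E)%E.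
Proof.
have t0 (a : mindex) : (0 <= (rnorm (c a) ^+ 2 / rho R m a)%:E)%E.
  by rewrite lee_fin divr_ge0 ?sqr_ge0// ltW// rho_gt0.
rewrite nneseries_esumT => [|k]; last by rewrite lee_fin degree_sqnorm_ge0.
rewrite /coef_sqnorm.
rewrite (_ : [set: mindex] = \bigcup_(k in [set: nat]) [set a : mindex | mdegree a = k]).
  rewrite esum_bigcupT//; last by move=> i j _ _ [a [/= <- <-]].
  apply: eq_esum => k _; rewrite esum_fset//; last exact: finite_degree.
  by rewrite fsbig_degs /degree_sqnorm sumEFin.
by apply/seteqP; split => // a _; exists (mdegree a).
Qed.

Lemma coef_sqnormP c (S : R) :
  coef_sqnorm m c = S%:E <-> (fun N => \sum_(k < N) degree_sqnorm c k) @ \oo --> S.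
Proof.
pose U N := \sum_(k < N) degree_sqnorm c k.
have E : (fun N => \sum_(0 <= k < N) (degree_sqnorm c k)%:E)%E = EFin \o U.
  by apply/funext => N; rewrite sumEFin /= /U big_mkord.
rewrite coef_sqnormE; split=> [US|US].
  have := @is_cvg_nneseries R (fun k => (degree_sqnorm c k)%:E) xpredT 0%N.
  move=> /(_ _)/wrap[k _ _|]; first by rewrite lee_fin degree_sqnorm_ge0.
  move: US; rewrite E => US cU.
  have h : (EFin \o U) @ \oo --> S%:E by rewrite -US; exact: cU.
  exact: fine_cvg h.
rewrite E; apply: cvg_lim => //; apply: cvg_EFin; [exact: nearW|exact: US].
Qed.

Lemma coef_sqnorm_lt_pinfty c : (coef_sqnorm m c < +oo)%E ->
  exists S : R, coef_sqnorm m c = S%:E.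
Proof.
move=> clt; exists (fine (coef_sqnorm m c)); rewrite fineK// ge0_fin_numE//.
rewrite coef_sqnormE.
apply: (@nneseries_ge0 R (fun k => (degree_sqnorm c k)%:E) xpredT 0%N) => k _ _.
by rewrite lee_fin degree_sqnorm_ge0.
Qed.

Lemma real_multinomial k (x : 'I_n -> R) :
  \sum_(a <- degs n k) multinom R a * \prod_(i < n) x i ^+ a i = (\sum_(i < n) x i) ^+ k.
Proof.
elim: k => [|k IH].
  by rewrite big_degs0 multinom0 mul1r big1// => i _; rewrite ffunE.
rewrite exprS -IH.
have -> := @sum_multinom_minc n R R^o k (fun a => \prod_(i < n) x i ^+ a i).
rewrite mulr_suml; apply: eq_bigr => i _; rewrite mulr_sumr; apply: eq_bigr => a _.
rewrite /GRing.scale /= mulrCA; congr (_ * _).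
rewrite (bigD1 i)//= [in RHS](bigD1 i)//= ffunE eqxx addn1 exprS -mulrA.
congr (_ * (_ * _)); apply: eq_bigr => j /negPf ji.
by rewrite ffunE ji addn0.
Qed.

(** [|z^a| |c a|] is at most half of [rho |z^a|^2 + |c a|^2 / rho]. The second summands add up to
    the norm of [c], the first to the diagonal value [(1 - |z|^2)^(-m)] of the reproducing
    kernel. *)
Lemma exists_expansion c (B : R) : (forall N, \sum_(k < N) degree_sqnorm c k <= B) ->
  exists f : uball R n -> V, has_expansion c f.
Proof.
move=> cB.
suff /choice[f fP] : forall z : uball R n, exists l : V,
    series (fun k => \sum_(a <- degs n k) monom (val z) a *: c a) @ \oo --> l.
  by exists f; apply/has_expansion_degs.
move=> [z z1] /=.
pose r := enorm z ^+ 2.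
have r01 : 0 <= r < 1 by rewrite sqr_ge0 expr_lt1// sqrtr_ge0.
have [K KP] := hcoef_series_bounded m r01.
have rE : r = \sum_(i < n) cabs (z ord0 i) ^+ 2.
  by rewrite /r /enorm sqr_sqrtr// sumr_ge0// => i _; exact: sqr_ge0.
have hE k : \sum_(a <- degs n k) rho R m a * cabs (monom z a) ^+ 2 = (hcoef m k)%:R * r ^+ k.
  rewrite rE -real_multinomial mulr_sumr big_seq [RHS]big_seq; apply: eq_bigr => a.
  rewrite mem_degs => /eqP ak; rewrite rhoE// ak -mulrA; congr (_ * (_ * _)).
  have cabsX (w : C) j : cabs (w ^+ j) = cabs w ^+ j.
    by elim: j => [|j IH]; rewrite ?expr0 ?cabs_real// !exprS cabsM IH.
  rewrite /monom; elim/big_rec2: _ => [|i x y _ <-]; first by rewrite cabs_real// expr1n.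
  by rewrite cabsM exprMn cabsX -!exprM mulnC.
pose b k := 2^-1 * ((hcoef m k)%:R * r ^+ k) + 2^-1 * degree_sqnorm c k.
apply: (@series_normal_cvg _ _ _ b (2^-1 * K + 2^-1 * B)) => [k|N]; last first.
  by rewrite /b big_split /= -!mulr_sumr; apply: lerD; apply: ler_wpM2l; rewrite ?invr_ge0 ?ler0n ?KP ?cB.
rewrite /b -hE /degree_sqnorm !mulr_sumr -big_split /=.
apply: (le_trans (ler_rnorm_sum _ _ _)); apply: ler_sum => a _.
rewrite rnormZ; have p := rho_gt0 a; set s := rho R m a in p *.
move: (cabs _) (rnorm _) => x y.
have : 0 <= (s * x - y) ^+ 2 / s by rewrite divr_ge0 ?sqr_ge0// ltW.
have -> : (s * x - y) ^+ 2 / s = s * x ^+ 2 - 2 * (x * y) + y ^+ 2 / s.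
  have s0 : s != 0 by rewrite gt_eqF.
  by field; rewrite s0.
by move: (s * x ^+ 2) (x * y) (y ^+ 2 / s) => u v w; lra.
Qed.

End coefficient_norm.

(** * Closed subspaces as Hilbert spaces *)

(** The model space in condition (iv) is a type, whereas [wandering T] is a set; a closed subspace
    is therefore made into a Hilbert space of its own. *)
Record closed_subspace (R : realType) (H : hilbertType R) := ClosedSubspace {
  subspace_carrier : set H;
  subspace_carrierP : subspace_set subspace_carrier;
  subspace_closed : closed subspace_carrier }.

Section subspace_hilbert.
Context (R : realType) (H : hilbertType R) (W : closed_subspace H).
Local Notation C := R[i].

Definition in_subspace : {pred H} := [pred x | `[< subspace_carrier W x >]].

Lemma in_subspaceP x : reflect (subspace_carrier W x) (x \in in_subspace).
Proof. exact: asboolP. Qed.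

Lemma in_subspace_submod : submod_closed in_subspace.
Proof.
have [W0 WL] := subspace_carrierP W.
split=> [|a x y /in_subspaceP Wx /in_subspaceP Wy]; apply/in_subspaceP => //.
exact: WL.
Qed.

HB.instance Definition _ := GRing.isSubmodClosed.Build C H in_subspace in_subspace_submod.

Record subspace_type := SubspaceType {
  subspace_val : H; subspace_valP : subspace_val \in in_subspace }.

HB.instance Definition _ := [isSub for subspace_val].
HB.instance Definition _ := [Choice of subspace_type by <:].
HB.instance Definition _ := [SubChoice_isSubLmodule of subspace_type by <:].

Let norm (x : subspace_type) : C := `|val x|.

Let norm_add x y : norm (x + y) <= norm x + norm y.
Proof. by rewrite /norm raddfD ler_normD. Qed.

Let norm_scale a x : norm (a *: x) = `|a| * norm x.
Proof. by rewrite /norm linearZ normrZ. Qed.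

Let norm_eq0 x : norm x = 0 -> x = 0.
Proof. by move=> /normr0_eq0 x0; apply: val_inj; rewrite x0 raddf0. Qed.

HB.instance Definition _ := Lmodule_isNormed.Build C subspace_type norm_add norm_scale norm_eq0.

Let complete (F : set_system subspace_type) : ProperFilter F -> cauchy F -> cvg F.
Proof.
move=> FF /cauchyP Fc.
have ballE (x y : subspace_type) e : ball x e y = ball (val x) e (val y).
  have xyE : `|x - y| = `|val x - val y| by rewrite -[LHS]/(`|val (x - y)|) raddfB.
  by rewrite -!ball_normE /= xyE.
have : cauchy (val @ F).
  apply: cauchy_exP => e /Fc[x Fx]; exists (val x).
  suff : F [set y | ball (val x) e (val y)] by [].
  by apply: filterS Fx => y; rewrite ballE.
move=> /cauchy_cvg/cvg_ex[l /= Fl].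
have Wl : subspace_carrier W l.
  move/closed_rnormP : (@subspace_closed _ _ W); apply => e e0.
  have /filter_ex[y] : F [set y | ball l e%:C (val y)].
    by apply: (Fl); apply: nbhsx_ballx; rewrite ltcR.
  rewrite -ball_normE /= norm_rnorm ltcR => ly; exists (val y) => //.
  exact/in_subspaceP/valP.
have Pl : l \in in_subspace by apply/in_subspaceP.
apply/cvg_ex; exists (SubspaceType Pl) => A /nbhs_ballP[e /= e0 eA].
have : F [set y | ball l e (val y)] by apply: (Fl); exact: nbhsx_ballx.
by apply: filterS => y ly; apply: eA; rewrite ballE.
Qed.

HB.instance Definition _ := Uniform_isComplete.Build subspace_type complete.

Let dot (x y : subspace_type) : C := hdot (val x) (val y).

Let dot_linear a x y z : dot (a *: x + y) z = a * dot x z + dot y z.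
Proof. by rewrite /dot linearP hdot_linearl. Qed.

Let dot_conj x y : dot y x = (dot x y)^*.
Proof. exact: hdot_conj. Qed.

Let dot_norm x : dot x x = `|x| ^+ 2.
Proof. exact: hdot_norm. Qed.

HB.instance Definition _ := CompleteNormedModule_isHilbert.Build R subspace_type
  dot_linear dot_conj dot_norm.

End subspace_hilbert.

(** * Multiplication by the coordinate functions *)

Section expansion_algebra.
Context (R : realType) (n : nat) (V : hilbertType R).
Local Notation C := R[i].
Local Notation mindex := {ffun 'I_n -> nat}.
Implicit Types (c : mindex -> V) (f g : uball R n -> V).

Lemma has_expansion_fun c f g : has_expansion c f -> has_expansion c g -> f = g.
Proof.
move=> cf cg; apply/funext => z; exact: (rnorm_limit_unique (cf z) (cg z)).
Qed.

Lemma has_expansion_linear (t : C) c c' f g : has_expansion c f -> has_expansion c' g ->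
  has_expansion (fun a => t *: c a + c' a) (t *: f + g).
Proof.
move=> /has_expansion_degs cf /has_expansion_degs cg; apply/has_expansion_degs => z.
have cv := cvgD (cvgZl_tmp (k := t) (cf z)) (cg z).
set F := (X in X @ _ --> _).
rewrite (_ : F = fun N =>
  t *: series (fun k => \sum_(a <- degs n k) monom (val z) a *: c a) N +
  series (fun k => \sum_(a <- degs n k) monom (val z) a *: c' a) N); first exact: cv.
apply/funext => N; rewrite /F /series /= scaler_sumr -big_split; apply: eq_bigr => k _.
rewrite /= scaler_sumr -big_split; apply: eq_bigr => a _ /=.
by rewrite scalerDr !scalerA [t * _]mulrC.
Qed.

Lemma has_expansion0 : has_expansion (fun=> 0 : V) (0 : uball R n -> V).
Proof.
apply/has_expansion_degs => z; apply/cvg_rnormP => e e0; exists 0%N => k _.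
rewrite subr0 /series /= big1 ?rnorm0// => j _.
by rewrite big1// => a _; rewrite scaler0.
Qed.

Lemma has_expansion_Mz i c f : has_expansion c f ->
  has_expansion (fun b => if (0 < b i)%N then c (mdec i b) else 0) (Mz i f).
Proof.
move=> /has_expansion_degs cf; apply/has_expansion_degs => z.
have cv := cvgZl_tmp (k := val z ord0 i) (cf z).
(* The product has no term of degree 0, so its partial sum of length [N + 1] is [z_i] times that of
   length [N]. *)
rewrite -cvg_shiftS; set F := (X in X @ _ --> _).
rewrite (_ : F = fun N => val z ord0 i *:
  series (fun k => \sum_(a <- degs n k) monom (val z) a *: c a) N); first exact: cv.
apply/funext => N; rewrite /F /series /= big_nat_recl// big_degs0 ffunE scaler0 add0r.
rewrite scaler_sumr; apply: eq_bigr => k _.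
rewrite (sum_degs_minc k i) [in RHS]big_mkcond scaler_sumr; apply: eq_bigr => b _.
case: ifP => bi; last by rewrite !scaler0.
by rewrite scalerA -monom_minc mdecK.
Qed.

Definition vanishing_order k f := exists2 c, has_expansion c f &
  forall a, (mdegree a < k)%N -> c a = 0.

Lemma vanishing_orderD k f g :
  vanishing_order k f -> vanishing_order k g -> vanishing_order k (f + g).
Proof.
move=> [c cf c0] [c' cg c'0]; rewrite -[f]scale1r.
exists (fun a => 1 *: c a + c' a); first exact: has_expansion_linear.
by move=> a ak; rewrite c0// c'0// scaler0 addr0.
Qed.

Lemma vanishing_order0 k : vanishing_order k (0 : uball R n -> V).
Proof. by exists (fun=> 0) => //; exact: has_expansion0. Qed.

Lemma vanishing_order_Mz k i f : vanishing_order k f -> vanishing_order k.+1 (Mz i f).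
Proof.
move=> [c cf c0].
exists (fun b : mindex => if (0 < b i)%N then c (mdec i b) else 0).
  exact: has_expansion_Mz.
move=> a ak; case: ifP => // ai; apply: c0.
by rewrite -ltnS -(mdegree_minc i) mdecK.
Qed.

Lemma vanishing_order_eq0 c f : has_expansion c f -> (forall k, vanishing_order k f) ->
  forall a, c a = 0.
Proof.
move=> cf vf a; have [c' c'f c'0] := vf (mdegree a).+1.
by rewrite (has_expansion_unique cf c'f) c'0.
Qed.

End expansion_algebra.

(** Each [T_i] becomes multiplication by a coordinate and raises the order of vanishing at the
    origin. For [x] in the intersection [U x] vanishes to every order, so all its coefficients are 0
    and the isometry gives [x = 0]. *)
Lemma unitarily_equiv_Mz_analytic (R : realType) (m n : nat) (H D : hilbertType R)
    (T : 'I_n -> H -> H) : (forall i, bounded_op (T i)) ->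
  unitarily_equiv_Mz m T D -> analytic_tuple T.
Proof.
move=> bT [U [rU nU UT]].
apply/seteqP; split => [x xT|_ -> k _]; last first.
  exists (fun=> 0); rewrite fsbig_degs big1// => a _.
  by rewrite (bounded_op0 (tuple_pow_bounded _ bT)).
have expU y : exists2 c, has_expansion c (U y) & forall a, [set: D] (c a).
  have : range U (U y) by exists y.
  by rewrite rU => -[c [? cU _]]; exists c.
have vU w y : vanishing_order (size w) (U (wordop T w y)).
  elim: w => [|i w IH] /=; first by have [c cU _] := expU y; exists c.
  rewrite UT; exact: vanishing_order_Mz.
have vUx k : vanishing_order k (U x).
  have [h ->] := xT k I; rewrite fsbig_degs linear_sum big_seq /=.
  elim/big_ind: _ => [|f g|a]; first exact: vanishing_order0.
    exact: vanishing_orderD.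
  by rewrite mem_degs => /eqP <-; rewrite tuple_pow_wordop -size_wordof; exact: vU.
have [c cU _] := expU x.
have := nU x; rewrite (Hm_sqnorm_expansion m cU) /coef_sqnorm esum1.
  by case=> /esym/eqP; rewrite sqrf_eq0 rnorm_eq0 => /eqP.
move=> a _; rewrite (vanishing_order_eq0 cU vUx a) rnorm0 expr0n /= mul0r.
by [].
Qed.

(** * Regular tuples *)

Section operators.
Context (R : realType) (m n : nat) (hm : (1 <= m)%N) (H : hilbertType R).
Local Notation C := R[i].
Local Notation mindex := {ffun 'I_n -> nat}.
Context (T : 'I_n -> H -> H).
Hypothesis bT : forall i, bounded_op (T i).
Hypothesis Tcomm : forall i j x, T i (T j x) = T j (T i x).
Hypothesis Tregular : regular_at0 T.
Hypothesis Tidentity : forall v, range (row_adj T) v ->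
  TstarT_inv T v = oplus (Delta_op m T) v.
Local Notation S i := (adjoint (T i)).
Local Notation W := (wandering T).
Local Notation P := (orthogonal_proj W).
Local Notation Delta := (Delta_op m T).
Local Notation sig k := (iter k (sigma_op T) idfun).

Let cT : closed (range (row_op T)) := Tregular.1.

Lemma bounded_adj i : bounded_op (S i).
Proof. exact: bounded_op_adjoint. Qed.

Lemma adj_comm i j x : S i (S j x) = S j (S i x).
Proof. by apply: hdot_ext => z; rewrite -!adjointP// Tcomm. Qed.

Lemma sigS k x : sig k.+1 x = \sum_(i < n) T i (sig k (S i x)).
Proof. by []. Qed.

Lemma bounded_sig k : bounded_op (sig k).
Proof.
elim: k => [|k IH]; first exact: bounded_op_idfun.
apply: bounded_op_bigsum => i; apply: (bounded_op_comp (bT i)).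
exact: (bounded_op_comp IH (bounded_adj i)).
Qed.

Lemma bounded_Delta : bounded_op Delta.
Proof. apply: bounded_op_bigsum => j; exact: bounded_op_scale (bounded_sig j). Qed.

Lemma L_opE i x : L_op T i x = Delta (S i x).
Proof. by rewrite /L_op Tidentity//; exists x. Qed.

Lemma bounded_L i : bounded_op (L_op T i).
Proof.
rewrite (_ : L_op T i = Delta \o S i); last by apply/funext => x; exact: L_opE.
exact: bounded_op_comp bounded_Delta (bounded_adj i).
Qed.

Lemma projE x : P x = x - row_op T (fun i => L_op T i x).
Proof. by have [] := orthogonal_projP bT cT x. Qed.

Lemma wandering_proj x : W (P x).
Proof. by rewrite projE; have [] := orthogonal_projP bT cT x. Qed.

Lemma bounded_proj : bounded_op P.
Proof.
rewrite (_ : P = fun x => x + (-1) *: \sum_(i < n) T i (L_op T i x)).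
  apply: bounded_op_add; first exact: bounded_op_idfun.
  apply: bounded_op_scale; apply: bounded_op_bigsum => i.
  exact: (bounded_op_comp (bT i) (bounded_L i)).
by apply/funext => x; rewrite projE scaleN1r.
Qed.

Lemma wandering_adj0 w i : W w -> S i w = 0.
Proof. by move/(wanderingP bT). Qed.

Lemma proj_wandering w : W w -> P w = w.
Proof.
move=> Ww; rewrite projE /row_op big1 ?subr0// => i _.
by rewrite L_opE wandering_adj0// (bounded_op0 bounded_Delta) (bounded_op0 (bT i)).
Qed.

Lemma proj_T i x : P (T i x) = 0.
Proof.
apply: hdot_ext => z; rewrite hdot0r hdot_conj.
have sW : subspace_set (range (row_op T)) := subspace_row_range bT.
have rT : range (row_op T) (T i x).
  exists (fun j => if j == i then x else 0) => //.
  rewrite /row_op (bigD1 i)//= eqxx big1 ?addr0// => j /negPf ->.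
  exact: (bounded_op0 (bT j)).
suff : rnorm (P (T i x)) ^+ 2 = 0.
  by move/eqP; rewrite sqrf_eq0 rnorm_eq0 => /eqP ->; rewrite hdot0l conjC0.
apply: (@complexI R); rewrite -hdotxx.
(* The vector lies in [W(T)] and, being [T_i x] minus an element of the range, also in the range; so
   it is orthogonal to itself. *)
by apply: (wandering_proj (T i x)); rewrite projE; apply: subspace_setB sW rT _; eexists.
Qed.

Lemma hdot_proj x w : W w -> hdot w (P x) = hdot w x.
Proof.
have rL : range (row_op T) (row_op T (fun i => L_op T i x)) by eexists.
by move=> Ww; rewrite projE hdotBr (Ww _ rL) subr0.
Qed.

(** * The homogeneous operators P (ZL)^k and their intertwining rules *)

Local Notation K z := (fun x => \sum_(i < n) z ord0 i *: S i x).

Lemma bounded_K (z : 'rV[C]_n) : bounded_op (K z).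
Proof. by apply: bounded_op_bigsum => i; apply: bounded_op_scale; exact: bounded_adj. Qed.

Lemma bounded_op_iter (f : H -> H) k : bounded_op f -> bounded_op (iter k f).
Proof.
move=> bf; elim: k => [|k IH]; first exact: bounded_op_idfun.
exact: (bounded_op_comp bf IH).
Qed.

(** Provides [(1 - t f)^(-1) x] for small positive [t], which is all that a comparison of
    coefficients in [t] requires. Since [t M <= 1/2], the series is dominated by a geometric one. *)
Lemma neumann (f : H -> H) : bounded_op f -> exists2 d : R, 0 < d &
  forall t : R, 0 < t < d -> forall x, exists2 s,
    series (fun k => (t ^+ k)%:C *: iter k f x) @ \oo --> s & s = x + t%:C *: f s.
Proof.
move=> bf; have [M M0 fM] := bf.2.
have M1 : 0 < M + 1 by rewrite ltr_wpDl.
exists (2^-1 / (M + 1)) => [|t /andP[t0 tM] x]; first by rewrite divr_gt0.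
have tM2 : t * M <= 2^-1.
  move: tM; rewrite ltr_pdivlMr// => /ltW; apply: le_trans.
  by rewrite ler_wpM2l ?(ltW t0)// lerDl.
pose b k := (2^-1) ^+ k * rnorm x.
have [k|N|s sP] := @series_normal_cvg R H (fun k => (t ^+ k)%:C *: iter k f x) b (2 * rnorm x).
- rewrite /b rnormZ cabs_real ?exprn_ge0 ?(ltW t0)//; elim: k => [|k IH] //=.
  rewrite !exprS -mulrA -mulrA.
  apply: (@le_trans _ _ ((t * M) * (t ^+ k * rnorm (iter k f x)))); last first.
    apply: ler_pM => //; first by rewrite mulr_ge0 ?(ltW t0).
    by rewrite mulr_ge0 ?rnorm_ge0// exprn_ge0 ?(ltW t0).
  rewrite -[t * M * _]mulrA ler_wpM2l ?(ltW t0)// mulrCA ler_wpM2l ?exprn_ge0 ?(ltW t0)//.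
- rewrite /b -mulr_suml ler_wpM2r ?rnorm_ge0//.
  suff : \sum_(i < N) 2^-1 ^+ i <= 2 - 2 * 2^-1 ^+ N :> R.
    by move/le_trans; apply; rewrite gerBl mulr_ge0 ?exprn_ge0.
  elim: N => [|N IH]; first by rewrite big_ord0 expr0 mulr1 subrr.
  rewrite big_ord_recr /= exprS; move: IH; move: (2^-1 ^+ N) (\sum_(i < N) _) => u v; lra.
exists s => //; set u := fun k => _ in sP.
have h := sP; rewrite -cvg_shiftS in h.
apply: (rnorm_limit_unique h).
have -> : [sequence series u N.+1]_N = fun N => x + t%:C *: f (series u N).
  apply/funext => N; rewrite /series /= big_nat_recl//= /u expr0 scale1r; congr (_ + _).
  rewrite bounded_op_sum// scaler_sumr; apply: eq_bigr => k _.
  by rewrite bounded_opZ// scalerA exprS rmorphM.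
apply: cvgD; first exact: cvg_cst.
exact: cvgZl_tmp (bounded_op_cvg bf sP).
Qed.

Local Notation Z z := (fun x => Delta (K z x)).

Lemma bounded_Z (z : 'rV[C]_n) : bounded_op (Z z).
Proof. exact: bounded_op_comp bounded_Delta (bounded_K z). Qed.

(** Through the identity for [TstarT_inv], [Delta K(z)] is the operator ZL of the overview. *)
Lemma Z_L (z : 'rV[C]_n) x : Z z x = \sum_(i < n) z ord0 i *: L_op T i x.
Proof.
rewrite /= (bounded_op_sum _ _ _ bounded_Delta); apply: eq_bigr => i _.
by rewrite (bounded_opZ _ _ bounded_Delta) L_opE.
Qed.

Local Notation A k z x := (P (iter k (Z z) x)).

(* For small [t], [s = (1 - t Z)^-1 x] satisfies
   [P s = x - (T - t z) (L s)]; when [x = (T_i - t z_i) y], regularity forces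
   [P s = 0], and one compares coefficients of [t]. *)
Lemma regular_proj (z : 'rV[C]_n) i k y : A k.+1 z (T i y) = z ord0 i *: A k z y.
Proof.
have [_ [eps eps0 reg]] := Tregular.
have [d d0 dP] := neumann (bounded_Z z).
(* The coefficients in [t] of [P s]. The factor [t z_i] shifts the second series by one degree, and
   degree 0 is empty because [P T_i = 0]. *)
pose v k := if k is l.+1 then A k z (T i y) - z ord0 i *: A l z y else 0.
suff : v k.+1 = 0 by move/eqP; rewrite subr_eq0 => /eqP.
have e1 : 0 < enorm z + 1 by rewrite ltr_wpDl// sqrtr_ge0.
(* Small enough both for the Neumann series and for [|t z| < eps]; the summand 1 covers [z = 0]. *)
pose d' := Num.min d (eps / (enorm z + 1)).
have d'0 : 0 < d' by rewrite lt_min d0 divr_gt0.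
apply: (power_series_unique d'0) => t /andP[t0]; rewrite lt_min => /andP[td te].
have tz : enorm (t%:C *: z) < eps.
  rewrite enormZ ?(ltW t0)//; move: te; rewrite ltr_pdivlMr//; apply: le_lt_trans.
  by rewrite ler_wpM2l ?(ltW t0)// lerDl.
have [|s1 s1P s1E] := dP t _ (T i y); first by rewrite t0.
have [|s2 s2P s2E] := dP t _ y; first by rewrite t0.
pose s := s1 - (t%:C * z ord0 i) *: s2.
have Ps : P s = 0.
  have [_ [_ TZW]] := reg _ tz.
  suff : [set 0 : H] (P s) by [].
  rewrite -TZW; split; last exact: wandering_proj.
  exists (fun j => (if j == i then y else 0) - L_op T j s) => //.
  have bL j x x' a : L_op T j (x - a *: x') = L_op T j x - a *: L_op T j x'.
    by rewrite (bounded_opB _ _ (bounded_L j)) (bounded_opZ _ _ (bounded_L j)).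
  have Zs : t%:C *: Z z s = row_op (scalar_tuple (t%:C *: z)) (fun j => L_op T j s).
    rewrite Z_L scaler_sumr; apply: eq_bigr => j _.
    by rewrite /scalar_tuple mxE scalerA.
  have sE : s = T i y - (t%:C * z ord0 i) *: y + t%:C *: Z z s.
    have alg (c : C) (p q p' q' : H) :
        (p + t%:C *: q) - c *: (p' + t%:C *: q') = p - c *: p' + t%:C *: (q - c *: q').
      by rewrite !scalerDr scalerN !scalerA [c * _]mulrC opprD addrACA.
    rewrite {2}/s (bounded_opB _ _ (bounded_Z z)) (bounded_opZ _ _ (bounded_Z z)).
    by rewrite -alg -s1E -s2E.
  have rowB (U : 'I_n -> H -> H) (h g : 'I_n -> H) : (forall j, bounded_op (U j)) ->
      row_op U (fun j => h j - g j) = row_op U h - row_op U g.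
    move=> bU; rewrite /row_op -sumrB; apply: eq_bigr => j _.
    by rewrite (bounded_opB _ _ (bU j)).
  have bsc (z' : 'rV[C]_n) j : bounded_op (scalar_tuple (H := H) z' j).
    exact: bounded_op_scale (bounded_op_idfun H).
  have rowd (U : 'I_n -> H -> H) : (forall j, bounded_op (U j)) ->
      row_op U (fun j => if j == i then y else 0) = U i y.
    move=> bU; rewrite /row_op (bigD1 i)//= eqxx big1 ?addr0// => j /negPf ->.
    by rewrite (bounded_op0 (bU j)).
  rewrite !rowB// !rowd// -Zs projE; set r := row_op T _.
  rewrite [X in _ = X - _]sE /scalar_tuple mxE opprB addrAC; congr (_ - r).
  by rewrite addrCA addrC.
have a1 := bounded_op_cvg bounded_proj s1P.
have a2 := bounded_op_cvg bounded_proj s2P.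
rewrite -cvg_shiftS; rewrite -cvg_shiftS in a1.
have cv := cvgB a1 (cvgZl_tmp (k := t%:C * z ord0 i) a2).
rewrite -(bounded_opZ _ _ bounded_proj) -(bounded_opB _ _ bounded_proj) -/s Ps in cv.
set f := (X in X @ _ --> _).
rewrite (_ : f = fun N =>
  P (series (fun k => (t ^+ k)%:C *: iter k (Z z) (T i y)) N.+1) -
  (t%:C * z ord0 i) *: P (series (fun k => (t ^+ k)%:C *: iter k (Z z) y) N)).
  exact: cv.
apply/funext => N; rewrite /f /= /series /= !big_nat_recl//= scaler0 add0r.
rewrite (bounded_opD _ _ bounded_proj) expr0 scale1r proj_T add0r.
rewrite !(bounded_op_sum _ _ _ bounded_proj) scaler_sumr -sumrB; apply: eq_bigr => l _.
rewrite !(bounded_opZ _ _ bounded_proj) scalerBr !scalerA; congr (_ - _ *: _).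
by rewrite exprS rmorphM mulrAC.
Qed.

Lemma bounded_A k (z : 'rV[C]_n) : bounded_op (fun x => A k z x).
Proof. exact: bounded_op_comp bounded_proj (bounded_op_iter k (bounded_Z z)). Qed.

Local Notation B k z x := (P (iter k (K z) x)).

(** Each outer [T_i] of [sigma^j(1)] is traded for [z_i] and one power of ZL, while the matching
    adjoints collect into [K(z)]. When the powers run out, [P T_i = 0] gives the zero branch. *)
Lemma A_sig k j (z : 'rV[C]_n) x : A k z (sig j x) =
  if (j <= k)%N then A (k - j) z (iter j (K z) x) else 0.
Proof.
elim: j k x => [|j IH] k x; first by rewrite subn0.
rewrite sigS (bounded_op_sum _ _ _ (bounded_A k z)).
case: k => [|k]; first by rewrite big1// => i _; exact: proj_T.
under eq_bigr do rewrite regular_proj.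
have -> : \sum_(i < n) z ord0 i *: A k z (sig j (S i x)) = A k z (sig j (K z x)).
  rewrite (bounded_op_sum _ _ _ (bounded_sig j)) (bounded_op_sum _ _ _ (bounded_A k z)).
  apply: eq_bigr => i _.
  by rewrite (bounded_opZ _ _ (bounded_sig j)) (bounded_opZ _ _ (bounded_A k z)).
by rewrite IH ltnS subSS iterSr.
Qed.

(** The two halves need one simultaneous strong induction: degree [k] of the first uses degree
    [k - 1] of the second, and the second uses the first in degrees up to [k], combined by
    [hcoef_rec]. *)
Lemma A_B_Delta k (z : 'rV[C]_n) :
  (forall x, A k z x = (hcoef m k)%:R *: B k z x) /\
  (forall x, A k z (Delta x) = (hcoef m k.+1)%:R *: B k z x).
Proof.
have [N] := ubnP k; elim: N k => // N IH k; rewrite ltnS => kN.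
have AB x : A k z x = (hcoef m k)%:R *: B k z x.
  case: k kN => [|k] kN; first by rewrite hcoefn0 scale1r.
  by rewrite !iterSr /= (IH k kN).2.
split=> // x.
rewrite {1}/Delta_op (bounded_op_sum _ _ _ (bounded_A k z)) (hcoef_rec C) scaler_suml.
apply: eq_bigr => j _; rewrite (bounded_opZ _ _ (bounded_A k z)) A_sig -[RHS]scalerA.
congr (_ *: _); case: leqP => jk; last by rewrite scale0r.
have -> : A (k - j) z (iter j (K z) x) = (hcoef m (k - j))%:R *: B (k - j) z (iter j (K z) x).
  (* [j = 0] is the current degree, outside the induction hypothesis but already settled as [AB]. *)
  have [->|j0] := eqVneq (j : nat) 0%N; first by rewrite subn0 AB.
  have kj : (k - j < N)%N.
    apply: leq_trans (_ : (k <= N)%N); last exact: kN.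
    rewrite ltn_subrL lt0n j0 /=; apply: leq_trans jk; by rewrite lt0n.
  by rewrite (IH _ kj).1.
by rewrite -iterD subnK.
Qed.

Lemma B_Delta k (z : 'rV[C]_n) x :
  (hcoef m k)%:R *: B k z (Delta x) = (hcoef m k.+1)%:R *: B k z x.
Proof. by rewrite -(A_B_Delta k z).1 (A_B_Delta k z).2. Qed.

Lemma B_T k (z : 'rV[C]_n) i x :
  (hcoef m k.+1)%:R *: B k.+1 z (T i x) = z ord0 i *: ((hcoef m k)%:R *: B k z x).
Proof. by rewrite -(A_B_Delta k.+1 z).1 regular_proj (A_B_Delta k z).1. Qed.

Lemma B_coef k (z : 'rV[C]_n) x :
  B k z x = \sum_(a <- degs n k) monom z a *: (multinom C a *: P (tuple_pow (fun i => S i) a x)).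
Proof.
rewrite (multinomial_iter adj_comm z k x bounded_adj) (bounded_op_sum _ _ _ bounded_proj).
apply: eq_bigr => a _; rewrite !(bounded_opZ _ _ bounded_proj) !scalerA.
by rewrite [monom z a * _]mulrC.
Qed.

Local Notation Sp a := (tuple_pow (fun i => S i) a).

Lemma Sp_minc a i x : Sp (minc i a) x = Sp a (S i x).
Proof.
rewrite (tuple_pow_minc adj_comm); exact: (tuple_powC adj_comm).
Qed.

(** Comparison of coefficients in [B_Delta], where the nonzero weight [multinom] cancels. Since
    [L_i = Delta S_i], this is what absorbs every [Delta] in a product of the [L_i]. *)
Lemma proj_Sp_Delta a x :
  (hcoef m (mdegree a))%:R *: P (Sp a (Delta x)) = (hcoef m (mdegree a).+1)%:R *: P (Sp a x) :> H.
Proof.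
set k := mdegree a.
pose v b : H := multinom C b *: ((hcoef m k)%:R *: P (Sp b (Delta x)) -
                                 (hcoef m k.+1)%:R *: P (Sp b x)).
have /eqP : v a = 0.
  apply: (@polynomial_coef_eq0 R n H k v) => // z _.
  transitivity ((hcoef m k)%:R *: B k z (Delta x) - (hcoef m k.+1)%:R *: B k z x).
    rewrite !B_coef [in RHS]scaler_sumr [X in _ - X]scaler_sumr -sumrB.
    apply: eq_bigr => b _; rewrite /v !scalerBr !scalerA; congr (_ *: _ - _ *: _); ring.
  by rewrite B_Delta subrr.
rewrite scaler_eq0 subr_eq0 => /orP[|/eqP//].
by rewrite gt_eqF// multinom_gt0.
Qed.

(** * The coefficient maps Q_a and their biorthogonality to the T^a *)

Definition coefQ (a : mindex) (x : H) : H := (rho R m a)%:C *: P (Sp a x).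
Local Notation Q := coefQ.

Lemma bounded_Sp a : bounded_op (Sp a).
Proof. by apply: tuple_pow_bounded => i; exact: bounded_adj. Qed.

Lemma bounded_coefQ a : bounded_op (coefQ a).
Proof. exact: bounded_op_scale (bounded_op_comp bounded_proj (bounded_Sp a)). Qed.

Lemma rhoCE (a : mindex) : (rho R m a)%:C = (hcoef m (mdegree a))%:R * multinom C a :> C.
Proof.
rewrite rhoE// rmorphM rmorph_nat; congr (_ * _).
by rewrite /multinom fmorph_div !rmorph_nat.
Qed.

Lemma wandering_coefQ a x : W (Q a x).
Proof.
exact: (subspace_setZ _ (subspace_orthogonal_compl (range (row_op T)))
  (wandering_proj (Sp a x))).
Qed.

Lemma coefQ_T b i x : Q b (T i x) = if (0 < b i)%N then Q (mdec i b) x else 0.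
Proof.
have [k bk] : exists k, mdegree b = k by exists (mdegree b).
(* Degree 0 stands apart, since [B_T] relates degree [k + 1] to degree [k]; there [P T_i = 0]
   suffices. *)
case: k bk => [|k] bk.
  have /eqP b0 : b == [ffun=> 0%N] by rewrite -mdegree_eq0 bk.
  by rewrite /coefQ b0 ffunE (tuple_pow0) proj_T scaler0.
pose v b : H := Q b (T i x) - (if (0 < b i)%N then Q (mdec i b) x else 0).
apply/eqP; rewrite -subr_eq0; apply/eqP.
apply: (@polynomial_coef_eq0 R n H k.+1 v) bk => z _.
rewrite /v; under eq_bigr do rewrite scalerBr.
rewrite sumrB; apply/eqP; rewrite subr_eq0; apply/eqP.
have -> : \sum_(b <- degs n k.+1) monom z b *: Q b (T i x) =
    (hcoef m k.+1)%:R *: B k.+1 z (T i x).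
  rewrite B_coef scaler_sumr big_seq [RHS]big_seq; apply: eq_bigr => c.
  rewrite mem_degs => /eqP ck; rewrite /coefQ rhoCE ck !scalerA; congr (_ *: _).
  by ring.
rewrite B_T B_coef !scaler_sumr (sum_degs_minc k i) big_mkcond big_seq [RHS]big_seq.
apply: eq_bigr => c; rewrite mem_degs => /eqP ck; case: ifP => ci; last by rewrite scaler0.
have -> : monom z c = z ord0 i * monom z (mdec i c) by rewrite -monom_minc mdecK.
rewrite /coefQ rhoCE !scalerA.
have -> : mdegree (mdec i c) = k.
  by apply: succn_inj; rewrite -(mdegree_minc i) mdecK.
congr (_ *: _); ring.
Qed.

(** The innermost letter is [Delta S_i], and [P S^w Delta] is a multiple of [P S^w]; the quotients
    of consecutive [hcoef] telescope. *)
Lemma proj_wordop_L w x : P (wordop (L_op T) w x) =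
  (hcoef m (size w))%:R *: P (wordop (fun i => S i) w x).
Proof.
elim/last_ind: w x => [|w i IH] x; first by rewrite hcoefn0 scale1r.
rewrite !wordop_rcons IH L_opE size_rcons (wordop_wtype adj_comm).
have <- : mdegree (wtype w) = size w.
  by elim: w {IH} => [|j w IHw] /=; rewrite ?mdegree0// mdegree_minc IHw.
exact: proj_Sp_Delta.
Qed.

Lemma gamma_L a x : gamma R a *: P (tuple_pow (L_op T) a x) = Q a x.
Proof.
rewrite !tuple_pow_wordop proj_wordop_L size_wordof -tuple_pow_wordop.
by rewrite /coefQ rhoCE scalerA mulrC.
Qed.

Lemma coefQ0 x : Q [ffun=> 0%N] x = P x.
Proof. by rewrite /coefQ (tuple_pow0) rhoCE mdegree0 hcoefn0 multinom0 mulr1 scale1r. Qed.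

Lemma coefQ_S_eq0 x i : (forall a, Q a x = 0) -> forall a, Q a (S i x) = 0.
Proof.
move=> x0 a; have := x0 (minc i a); rewrite /coefQ => /eqP.
have rho0 (b : mindex) : (rho R m b)%:C != 0 :> C by rewrite gt_eqF// ltcR rho_gt0.
rewrite scaler_eq0 (negPf (rho0 _)) /= Sp_minc.
by move/eqP => ->; rewrite scaler0.
Qed.

Lemma coefQ_wandering a w : W w -> Q a w = if a == [ffun=> 0%N] then w else 0.
Proof.
move=> Ww; case: eqP => [->|/eqP a0]; first by rewrite coefQ0 proj_wandering.
have [|i ai] := @mdegree_gt0_exists n a; first by rewrite lt0n mdegree_eq0.
rewrite /coefQ -(mdecK ai) Sp_minc.
by rewrite wandering_adj0// (bounded_op0 (bounded_Sp _)) (bounded_op0 bounded_proj) scaler0.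
Qed.

Lemma coefQ_Tpow a b w : W w -> Q a (tuple_pow T b w) = if a == b then w else 0.
Proof.
move=> Ww; have [s <-] := wtype_surj b; rewrite -(wordop_wtype Tcomm).
elim: s a => [|i s IH] a /=; first exact: coefQ_wandering.
rewrite coefQ_T IH; case: (ltnP 0 (a i)) => ai.
  congr (if _ then _ else _); apply/eqP/eqP => [<-|->]; first by rewrite mdecK.
  by rewrite mincK.
case: eqP => // aE; move: ai; rewrite aE leqNgt; by rewrite minc_gt0.
Qed.

Lemma hdot_tuple_pow a x y : hdot (tuple_pow T a x) y = hdot x (Sp a y).
Proof.
have [s <-] := wtype_surj a; rewrite -(wordop_wtype Tcomm) -(wordop_wtype adj_comm).
elim: s x y => //= i s IH x y; rewrite adjointP// IH (wordop_wtype adj_comm).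
by congr hdot; exact: esym (tuple_powC adj_comm i (wtype s) y).
Qed.

(** Up to the weight [1 / rho], [T^a] on [W(T)] is the adjoint of [Q_a], which makes synthesis
    adjoint to the coefficient map for the weighted norm. *)
Lemma hdot_tuple_pow_coefQ a w x : W w ->
  hdot (tuple_pow T a w) x = (rho R m a)^-1%:C * hdot w (Q a x).
Proof.
move=> Ww; rewrite hdot_tuple_pow -hdot_proj// /coefQ hdotZr.
rewrite (_ : ((rho R m a)%:C)^* = (rho R m a)%:C); last exact: conjc_real.
by rewrite mulrA -rmorphM mulVf ?mul1r// gt_eqF// rho_gt0.
Qed.

(** * Synthesis of vectors from coefficients *)

Definition synth_term (c : mindex -> H) k : H := \sum_(a <- degs n k) tuple_pow T a (c a).

Section synthesis.
Context (c : mindex -> H).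
Hypothesis Wc : forall a, W (c a).
Local Notation p := (synth_term c).
Local Notation q := (degree_sqnorm m c).

Lemma coefQ_synth_term k b : Q b (p k) = if mdegree b == k then c b else 0.
Proof.
rewrite (bounded_op_sum _ _ _ (bounded_coefQ b)).
rewrite (eq_bigr (fun a => if b == a then c a else 0)) => [|a _]; last exact: coefQ_Tpow.
rewrite -mem_degs; case: ifP => bk.
  rewrite (bigD1_seq b) ?degs_uniq//= eqxx big1 ?addr0// => a /negPf.
  by rewrite eq_sym => ->.
by rewrite big1_seq// => a /andP[_ ak]; case: eqP => // ba; rewrite ba ak in bk.
Qed.

Lemma hdot_synth_term k x :
  hdot (p k) x = \sum_(a <- degs n k) (rho R m a)^-1%:C * hdot (c a) (Q a x).
Proof. by rewrite hdot_suml; apply: eq_bigr => a _; exact: hdot_tuple_pow_coefQ. Qed.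

Lemma hdot_synth_coef k x : (forall a, mdegree a = k -> Q a x = c a) ->
  hdot (p k) x = (q k)%:C.
Proof.
move=> Qx; rewrite hdot_synth_term /degree_sqnorm rmorph_sum big_seq [RHS]big_seq.
apply: eq_bigr => a; rewrite mem_degs => /eqP /Qx ->.
by rewrite hdotxx -rmorphM mulrC.
Qed.

Lemma hdot_synth_termE k l : hdot (p k) (p l) = if k == l then (q k)%:C else 0.
Proof.
case: eqP => [<-|/eqP kl].
  by apply: hdot_synth_coef => a ak; rewrite coefQ_synth_term ak eqxx.
rewrite hdot_synth_term big1_seq// => a /andP[_]; rewrite mem_degs => /eqP ak.
by rewrite coefQ_synth_term ak (negPf kl) hdot0r mulr0.
Qed.

Lemma rnorm_synth i j : rnorm (\sum_(i <= k < j) p k) ^+ 2 = \sum_(i <= k < j) q k.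
Proof.
apply: (@complexI R); rewrite -hdotxx hdot_suml rmorph_sum big_seq [RHS]big_seq.
apply: eq_bigr => k kij; rewrite hdot_sumr (bigD1_seq k) ?iota_uniq//=.
rewrite hdot_synth_termE eqxx big1 ?addr0// => l /negPf lk.
by rewrite hdot_synth_termE eq_sym lk.
Qed.

(** Terms of different degrees are orthogonal with squared norms [degree_sqnorm], so summability
    makes the series Cauchy. The result is a right inverse of the coefficient map, hence its
    surjectivity onto H_m. *)
Lemma synthesis (Bd : R) : (forall N, \sum_(k < N) q k <= Bd) -> exists y : H,
  (forall a, Q a y = c a) /\ (fun N => \sum_(k < N) q k) @ \oo --> rnorm y ^+ 2.
Proof.
move=> qB; have q0 k := degree_sqnorm_ge0 hm c k.
have [L qL leL] := nonneg_partial_sums_cvg q0 qB.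
have [y py] : exists y : H, series p @ \oo --> y.
  apply: cauchy_rnorm => e e0; have e2 : 0 < e ^+ 2 by rewrite exprn_gt0.
  have [N _ NP] : \forall N \near \oo, L - e ^+ 2 < \sum_(k < N) q k.
    by apply: cvgr_gt qL _ _; rewrite ltrBlDr ltrDl.
  have le_ij i j : (N <= i <= j)%N -> rnorm (series p j - series p i) < e.
    move=> /andP[Ni ij]; have -> : series p j - series p i = \sum_(i <= k < j) p k.
      by rewrite /series /= (big_cat_nat (leq0n i) ij)//= addrAC subrr add0r.
    rewrite -(@ltr_pXn2r _ 2) ?nnegrE ?rnorm_ge0 ?(ltW e0)// rnorm_synth.
    have := leL j; have := NP _ Ni; rewrite -!(big_mkord xpredT).
    rewrite (big_cat_nat (leq0n i) ij)//=.
    by move: (\sum_(0 <= k < i) _) (\sum_(i <= k < j) _) => u v; lra.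
  exists N => i j Ni Nj; have [ij|ji] := leqP i j.
    by rewrite rnorm_distC le_ij// Ni ij.
  by rewrite le_ij// Nj ltnW.
have Qy a : Q a y = c a.
  apply: (rnorm_limit_unique (bounded_op_cvg (bounded_coefQ a) py)).
  apply/cvg_rnormP => e e0; exists (mdegree a).+1 => N aN.
  rewrite /= /series /= (bounded_op_sum _ _ _ (bounded_coefQ a)).
  rewrite big_mkord (bigD1 (Ordinal aN))//= coefQ_synth_term eqxx big1 ?addr0 ?subrr ?rnorm0//.
  move=> k /eqP ka; rewrite coefQ_synth_term; case: eqP => // ak.
  by case: ka; apply: val_inj.
exists y; split=> //.
have yN N : rnorm (series p N - y) ^+ 2 = rnorm y ^+ 2 - \sum_(k < N) q k.
  rewrite rnorm_sqrB /series /= rnorm_synth -(big_mkord xpredT (fun k => q k)).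
  have -> : rdot (\sum_(0 <= k < N) p k) y = \sum_(0 <= k < N) q k.
    rewrite /rdot hdot_suml cRe_sum; apply: eq_bigr => k _.
    by rewrite hdot_synth_coef.
  by ring.
apply/cvgrPdist_lt => e e0.
(* Below 1 the square of the distance is at most the distance, hence the minimum with 1. *)
have /cvg_rnormP/(_ (Num.min 1 e))[|N NP] := py; first by rewrite lt_min ltr01.
exists N => // k /= Nk; rewrite -yN ger0_norm ?sqr_ge0//.
have := NP _ Nk; rewrite lt_min => /andP[l1 le]; apply: le_lt_trans le.
by rewrite expr2 ler_piMr ?rnorm_ge0// ltW.
Qed.

End synthesis.

Lemma bessel x N : \sum_(k < N) degree_sqnorm m (Q^~ x) k <= rnorm x ^+ 2.
Proof.
have WQ a : W (Q a x) := wandering_coefQ a x.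
have := sqr_ge0 (rnorm (\sum_(0 <= k < N) synth_term (Q^~ x) k - x)).
rewrite rnorm_sqrB (rnorm_synth WQ).
have -> : rdot (\sum_(0 <= k < N) synth_term (Q^~ x) k) x =
    \sum_(0 <= k < N) degree_sqnorm m (Q^~ x) k.
  rewrite /rdot hdot_suml cRe_sum; apply: eq_bigr => k _.
  by rewrite (hdot_synth_coef WQ).
by rewrite -(big_mkord xpredT); move: (\sum_(0 <= k < N) _) => u; lra.
Qed.

Definition coefQ_injective := forall x, (forall a, Q a x = 0) -> x = 0.

(** The vector synthesised from the coefficients of [x] has the same coefficients, so it is [x] by
    injectivity, and synthesis computes its norm. *)
Lemma coefQ_isometry x : coefQ_injective ->
  (fun N => \sum_(k < N) degree_sqnorm m (Q^~ x) k) @ \oo --> rnorm x ^+ 2.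
Proof.
move=> inj; have [y [Qy]] := synthesis (wandering_coefQ ^~ x) (bessel x).
suff -> : y = x by [].
apply/eqP; rewrite -subr_eq0; apply/eqP/inj => a.
by rewrite (bounded_opB _ _ (bounded_coefQ a)) Qy subrr.
Qed.

(** * Injectivity of the coefficient map from analyticity *)

Definition degree_space k : set H := [set x | exists h : mindex -> H,
  x = \sum_(a \in [set a : mindex | mdegree a = k]) tuple_pow T a (h a)].

Lemma degree_space_row k (y : 'I_n -> H) : (forall i, degree_space k (y i)) ->
  degree_space k.+1 (row_op T y).
Proof.
move=> /choice[h hP].
exists (fun b : mindex => \sum_(i < n) if (0 < b i)%N then h i (mdec i b) else 0).
rewrite fsbig_degs /row_op.
transitivity (\sum_(b <- degs n k.+1) \sum_(i < n)
    if (0 < b i)%N then tuple_pow T b (h i (mdec i b)) else 0); last first.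
  apply: eq_bigr => b _; rewrite (bounded_op_sum _ _ _ (tuple_pow_bounded _ bT)).
  apply: eq_bigr => i _; case: ifP => // _.
  by rewrite (bounded_op0 (tuple_pow_bounded _ bT)).
rewrite exchange_big /=; apply: eq_bigr => i _.
rewrite hP fsbig_degs (bounded_op_sum _ _ _ (bT i)) (sum_degs_minc k i) -big_mkcond.
by apply: eq_bigr => b bi; rewrite -(tuple_pow_minc Tcomm) mdecK.
Qed.

Lemma analytic_coefQ_injective : analytic_tuple T -> coefQ_injective.
Proof.
move=> anT x x0; suff : [set 0 : H] x by [].
rewrite -anT => k _; rewrite -[X in X x]/(degree_space k).
elim: k x x0 => [|k IH] x x0.
  by exists (fun=> x); rewrite fsbig_degs big_degs0 (tuple_pow0 T).
have -> : x = row_op T (fun i => L_op T i x).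
  by apply/eqP; rewrite -subr_eq0 -projE -coefQ0 x0.
apply: degree_space_row => i; apply: IH => a.
(* [L_i x = Delta S_i x] again has vanishing coefficients: [proj_Sp_Delta] reduces them to those of
   [S_i x]. *)
have h0 : (hcoef m (mdegree a))%:R != 0 :> C by rewrite pnatr_eq0 -lt0n hcoef_gt0.
have r0 : (rho R m a)%:C != 0 :> C by rewrite gt_eqF// ltcR rho_gt0.
have := coefQ_S_eq0 i x0 a; rewrite /coefQ => /eqP.
rewrite scaler_eq0 (negPf r0) /= => /eqP Sx0.
have /eqP := proj_Sp_Delta a (S i x); rewrite Sx0 scaler0 scaler_eq0 (negPf h0) /=.
by rewrite L_opE => /eqP ->; rewrite scaler0.
Qed.

(** * Type C.0 and the iterates of sigma *)

Lemma proj_sig x : P x = \sum_(j < m.+1) ((-1) ^+ j * ('C(m, j))%:R : C) *: sig j x.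
Proof.
rewrite projE big_ord_recl bin0 mulr1 scale1r; congr (_ + _).
rewrite /row_op.
transitivity (- \sum_(j < m) ((-1) ^+ j * ('C(m, j.+1))%:R : C) *: sig j.+1 x).
  congr (- _); under eq_bigr do rewrite L_opE /Delta_op (bounded_op_sum _ _ _ (bT _)).
  rewrite exchange_big /=; apply: eq_bigr => j _; rewrite /sigma_op scaler_sumr.
  by apply: eq_bigr => i _; rewrite (bounded_opZ _ _ (bT i)).
rewrite -sumrN; apply: eq_bigr => j _.
by rewrite lift0 exprS mulN1r mulNr scaleNr.
Qed.

Lemma Cdot0_coefQ_injective : type_Cdot0 T -> coefQ_injective.
Proof.
move=> T0 x x0.
(* The [m]-th difference at [k] is [sigma^k(P) y], a sum of vectors [T^w P S^w y] over words of
   length [k], which vanish with the coefficients of [y]. The induction peels off the outer [T_i]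
   together with the inner [S_i]. *)
have D0 k y : (forall a, Q a y = 0) -> iter m (@forward C H) (fun j => sig j y) k = 0.
  move=> y0; rewrite iter_forward; elim: k y y0 => [|k IH] y y0.
    by have := y0 [ffun=> 0%N]; rewrite coefQ0 proj_sig.
  transitivity (\sum_(i < n) T i (\sum_(j < m.+1) ((-1) ^+ j * ('C(m, j))%:R : C) *:
      sig (k + j)%N (S i y))).
    under [RHS]eq_bigr do rewrite (bounded_op_sum _ _ _ (bT _)).
    rewrite exchange_big; apply: eq_bigr => j _.
    rewrite addSn sigS scaler_sumr; apply: eq_bigr => i _.
    by rewrite (bounded_opZ _ _ (bT i)).
  rewrite big1// => i _; rewrite IH ?(bounded_op0 (bT i))//; exact: coefQ_S_eq0.
exact: (iter_forward_eq0 (T0 x) (fun k => D0 k x x0) 0%N).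
Qed.

(** The quadratic form of [sigma^k(P)], written d_k in the overview. *)
Definition degree_sum k x : R := \sum_(a <- degs n k) multinom R a * rnorm (P (Sp a x)) ^+ 2.

Lemma degree_sum_ge0 k x : 0 <= degree_sum k x.
Proof.
by apply: sumr_ge0 => a _; rewrite mulr_ge0 ?sqr_ge0// ltW// multinom_gt0.
Qed.

Lemma degree_sumS k x : degree_sum k.+1 x = \sum_(i < n) degree_sum k (S i x).
Proof.
have := @sum_multinom_minc n R R^o k (fun a => rnorm (P (Sp a x)) ^+ 2).
rewrite -[X in X = _]/(degree_sum k.+1 x) => ->.
by apply: eq_bigr => i _; apply: eq_bigr => a _; rewrite Sp_minc.
Qed.

Lemma degree_sqnorm_coefQ k x :
  degree_sqnorm m (Q^~ x) k = (hcoef m k)%:R * degree_sum k x.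
Proof.
rewrite /degree_sqnorm mulr_sumr big_seq [RHS]big_seq; apply: eq_bigr => a.
rewrite mem_degs => /eqP ak; have r0 := rho_gt0 R hm a.
rewrite /coefQ rnormZ cabs_real ?(ltW r0)// mulrA -[in RHS]ak -rhoE// exprMn.
by rewrite mulrAC expr2 mulfK ?gt_eqF.
Qed.

Definition sig_form k x : R := rdot (sig k x) x.

Lemma sig_formS k x : sig_form k.+1 x = \sum_(i < n) sig_form k (S i x).
Proof.
rewrite /sig_form sigS /rdot hdot_suml cRe_sum; apply: eq_bigr => i _.
by rewrite adjointP.
Qed.

Lemma sig_form_ge0 k x : 0 <= sig_form k x.
Proof.
elim: k x => [|k IH] x; first by rewrite /sig_form rdotxx sqr_ge0.
by rewrite sig_formS sumr_ge0.
Qed.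

Lemma sig_selfadjoint k x y : hdot (sig k x) y = hdot x (sig k y).
Proof.
elim: k x y => // k IH x y; rewrite !sigS hdot_suml hdot_sumr.
by apply: eq_bigr => i _; rewrite adjointP// IH [RHS]adjointP'.
Qed.

(** A positive contraction satisfies [A^2 <= A], as positivity tested on [x - A x] shows. This
    upgrades decay of the forms [<A x, x>] to strong convergence. *)
Lemma sig_contractive k : (forall x, sig_form k x <= rnorm x ^+ 2) ->
  forall x, rnorm (sig k x) ^+ 2 <= sig_form k x.
Proof.
move=> le1 x; set y := sig k x.
have := sig_form_ge0 k (x - y); have := le1 y.
rewrite /sig_form (bounded_opB _ _ (bounded_sig k)) -/y.
have E : rdot (sig k y) x = rnorm y ^+ 2 by rewrite /rdot sig_selfadjoint -/(rdot y y) rdotxx.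
by rewrite !rdotDl !rdotDr !rdotNl !rdotNr E rdotxx; lra.
Qed.

Lemma isometry_Cdot0 :
  (forall x, (fun N => \sum_(k < N) degree_sqnorm m (Q^~ x) k) @ \oo --> rnorm x ^+ 2) ->
  type_Cdot0 T.
Proof.
move=> iso x.
(* The isometry is used at the vectors [S^b y] with [|b| = N]: passing from [y] to the [S_i y]
   raises the index of [degree_sum] and leaves the weight [hcoef m k] untouched. *)
have tail N : forall y, (fun M => \sum_(k < M) (hcoef m k)%:R * degree_sum (k + N) y) @ \oo
    --> sig_form N y.
  elim: N => [|N IH] y.
    rewrite /sig_form rdotxx; have := iso y; set f := (X in X @ _ --> _ -> _).
    set g := (X in _ -> X @ _ --> _); suff -> : f = g by [].
    apply/funext => M; apply: eq_bigr => k _.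
    by rewrite degree_sqnorm_coefQ addn0.
  rewrite sig_formS; set f := (X in X @ _ --> _).
  have -> : f = fun M => \sum_(i < n) \sum_(k < M) (hcoef m k)%:R * degree_sum (k + N) (S i y).
    apply/funext => M; rewrite exchange_big /=; apply: eq_bigr => k _.
    by rewrite addnS degree_sumS mulr_sumr.
  elim: (index_enum _) => [|i r IHr].
    rewrite big_nil (_ : (fun _ => _) = fun=> 0); first exact: cvg_cst.
    by apply/funext => M; rewrite big_nil.
  rewrite big_cons (_ : (fun _ => _) = fun M =>
      \sum_(k < M) (hcoef m k)%:R * degree_sum (k + N) (S i y) +
      \sum_(j <- r) \sum_(k < M) (hcoef m k)%:R * degree_sum (k + N) (S j y)).
    exact: cvgD (IH _) IHr.
  by apply/funext => M; rewrite big_cons.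
pose Sn N y := \sum_(k < N) degree_sqnorm m (Q^~ y) k.
have Sn_le N y : Sn N y <= rnorm y ^+ 2 by exact: bessel.
(* The weights are nondecreasing, so [hcoef m k] may be replaced by [hcoef m (k + N)]; Bessel's
   inequality then bounds the first [N] terms and the tail together. *)
have le_tail N y : sig_form N y <= rnorm y ^+ 2 - Sn N y.
  apply: (cvgr_to_le (tail N y)); apply: nearW => M.
  rewrite lerBrDl; apply: le_trans (Sn_le (N + M)%N y).
  rewrite /Sn big_split_ord /= lerD2l; apply: ler_sum => k _.
  rewrite degree_sqnorm_coefQ addnC ler_wpM2r ?degree_sum_ge0//.
  by rewrite ler_nat [(N + k)%N]addnC leq_hcoef.
have le1 N y : sig_form N y <= rnorm y ^+ 2.
  apply: (le_trans (le_tail N y)); rewrite gerBl sumr_ge0// => k _.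
  exact: degree_sqnorm_ge0.
apply/cvg_rnormP => e e0.
have e2 : 0 < e ^+ 2 by rewrite exprn_gt0.
have [N _ NP] : \forall N \near \oo, rnorm x ^+ 2 - e ^+ 2 < Sn N x.
  by apply: cvgr_gt (iso x) _ _; rewrite ltrBlDr ltrDl.
exists N => k Nk; rewrite subr0 -(@ltr_pXn2r _ 2) ?nnegrE ?rnorm_ge0 ?(ltW e0)//.
apply: (le_lt_trans (sig_contractive (le1 k) x)).
by apply: (le_lt_trans (le_tail k x)); have := NP _ Nk; lra.
Qed.

(** * Expansions and the unitary model *)

Local Notation Lcoef x := (fun a => gamma R a *: P (tuple_pow (L_op T) a x)).

Lemma LcoefE x : Lcoef x = Q^~ x.
Proof. by apply/funext => a; exact: gamma_L. Qed.

Lemma isometry_of_expansions :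
  (forall x, exists f : uball R n -> H, [/\ has_expansion (Lcoef x) f, Hm m W f
     & (rnorm x ^+ 2)%:E = Hm_sqnorm m f]) ->
  forall x, (fun N => \sum_(k < N) degree_sqnorm m (Q^~ x) k) @ \oo --> rnorm x ^+ 2.
Proof.
move=> h x; have [f [fL _ fn]] := h x; rewrite LcoefE in fL.
by apply/(coef_sqnormP hm); rewrite fn (Hm_sqnorm_expansion m fL).
Qed.

Lemma injective_expansions x : coefQ_injective -> exists f : uball R n -> H,
  [/\ has_expansion (Lcoef x) f, Hm m W f & (rnorm x ^+ 2)%:E = Hm_sqnorm m f].
Proof.
move=> inj; rewrite LcoefE.
have cs : coef_sqnorm m (Q^~ x) = (rnorm x ^+ 2)%:E.
  by apply/(coef_sqnormP hm); exact: coefQ_isometry.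
have [f fP] := exists_expansion hm (bessel x).
exists f; split => //; last by rewrite (Hm_sqnorm_expansion m fP).
exists (Q^~ x); split => //; last by rewrite cs ltry.
by move=> a; exact: wandering_coefQ.
Qed.

Lemma injective_unitarily_equiv : coefQ_injective ->
  exists D : hilbertType R, unitarily_equiv_Mz m T D.
Proof.
move=> inj.
pose Wc := @ClosedSubspace R H W (subspace_orthogonal_compl _)
  (@closed_orthogonal_compl R H _).
pose D : hilbertType R := subspace_type Wc.
have QW a x : Q a x \in in_subspace Wc.
  by apply/in_subspaceP; exact: wandering_coefQ.
pose c x a : D := SubspaceType (QW a x).
have cL (t : C) x y a : c (t *: x + y) a = t *: c x a + c y a.
  apply: val_inj; rewrite linearP /=; exact: (bounded_coefQ a).1.
have cq x k : degree_sqnorm m (c x) k = degree_sqnorm m (Q^~ x) k by [].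
have /choice[U0 U0P] : forall x, exists f : uball R n -> D, has_expansion (c x) f.
  move=> x; apply: (@exists_expansion R n m D hm (c x) (rnorm x ^+ 2)) => N.
  by under eq_bigr do rewrite cq; exact: bessel.
have U0L : linear U0.
  move=> t x y; apply: has_expansion_fun (U0P _) _.
  by rewrite (funext (cL t x y)); exact: has_expansion_linear.
pose U : {linear H -> (uball R n -> D)} := HB.pack U0 (GRing.isLinear.Build _ _ _ _ _ U0L).
exists D, U; split.
- apply/seteqP; split => [_ [x _ <-]|f [c' [_ c'f c'lt]]].
    exists (c x); split => //.
    suff -> : coef_sqnorm m (c x) = (rnorm x ^+ 2)%:E by rewrite ltry.
    apply/(coef_sqnormP hm); exact: coefQ_isometry.
  (* Surjectivity: coefficients of finite norm in the model space, read in [H], are synthesised into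
     a vector. *)
  have [B /(coef_sqnormP hm) c'B] := coef_sqnorm_lt_pinfty hm c'lt.
  have Wc' a : W (val (c' a)) by have /in_subspaceP := valP (c' a).
  have [|y [Qy _]] := @synthesis (fun a => val (c' a)) Wc' B.
    move=> N; rewrite -(cvg_lim (@Rhausdorff R) c'B); apply: nondecreasing_cvgn_le.
      apply/nondecreasing_seqP => k; rewrite big_ord_recr /= lerDl.
      exact: degree_sqnorm_ge0.
    by apply/cvg_ex; exists B.
  exists y => //; apply: has_expansion_fun (U0P y) _.
  suff -> : c y = c' by [].
  by apply/funext => a; apply: val_inj; exact: Qy.
- move=> x; rewrite (Hm_sqnorm_expansion m (U0P x)).
  apply/(coef_sqnormP hm); exact: coefQ_isometry.
- move=> i x; apply: has_expansion_fun (U0P _) _.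
  suff -> : c (T i x) = fun b => if (0 < b i)%N then c x (mdec i b) else 0.
    exact: has_expansion_Mz (U0P x).
  apply/funext => b; apply: val_inj; rewrite /= coefQ_T.
  by case: ifP.
Qed.

End operators.

Theorem corollary9 (R : realType) (m n : nat) (hm : (1 <= m)%N) (hn : (1 <= n)%N)
  (H : hilbertType R) (T : 'I_n -> {linear H -> H})
  (Tbounded : forall i, continuous (T i))
  (Tcomm : forall i j x, T i (T j x) = T j (T i x))
  (Tregular : regular_at0 T)
  (Tidentity : forall v, range (row_adj T) v ->
     TstarT_inv T v = oplus (Delta_op m T) v) :
  [<-> analytic_tuple T;
       forall x : H, exists f : uball R n -> H,
         [/\ has_expansion (fun a => gamma R a *:
               orthogonal_proj (wandering T) (tuple_pow (L_op T) a x)) f,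
             Hm m (wandering T) f
           & (rnorm x ^+ 2)%:E = Hm_sqnorm m f];
       type_Cdot0 T;
       exists D : hilbertType R, unitarily_equiv_Mz m T D].
Proof.
have bT i : bounded_op (T i) := continuous_bounded_op (Tbounded i).
tfae.
- move=> an x.
  apply: (injective_expansions hm bT Tcomm Tregular Tidentity).
  exact: (analytic_coefQ_injective hm bT Tcomm Tregular Tidentity).
- move=> expansions.
  apply: (isometry_Cdot0 hm bT Tcomm Tregular Tidentity).
  exact: (isometry_of_expansions hm bT Tcomm Tregular Tidentity).
- move=> C0.
  apply: (injective_unitarily_equiv hm bT Tcomm Tregular Tidentity).
  exact: (Cdot0_coefQ_injective hm bT Tcomm Tregular Tidentity).
- by move=> [D]; exact: unitarily_equiv_Mz_analytic.
Qed.
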